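(* For $0\le i,j,k\le n-1$, the type $(0,3)$ categorical Gromov-Witten invariant of $A_n$ is given by $$\langle[\epsilon|\epsilon^i],[\epsilon|\epsilon^j],[\epsilon|\epsilon^k]\rangle_{0,3}^{A_n}=\begin{cases}1,&\text{if }i+j+k=2n-2,\\0,&\text{otherwise.}\end{cases}$$
   Context: $\mathbb{K}$ is a field of characteristic $0$, $n\ge1$. Shifted sign conventions are used for $A_\infty$ algebras and signs $\pm$ are Koszul signs. $A_n=\mathrm{span}(\mathbf 1,\epsilon)$ is the $\mathbb{Z}/2\mathbb{Z}$-graded cyclic $A_\infty$ algebra with $\mathbf 1$ even and a strict unit, $\epsilon$ odd, only other non-zero operation $\mu_{n+1}(\epsilon,\dots,\epsilon)=\frac1{n+1}\mathbf 1$, and odd pairing $\langle\mathbf 1,\epsilon\rangle=1$. It is the minimal model of the category of matrix factorizations of $\frac1{n+1}x^{n+1}$. **Chains.** $L:=CC_{*+1}(A_n)$ is the shifted reduced Hochschild chain complex (unit killed in all slots but the $0$-th), with basis $\mathbf 1|\epsilon^k,\ \epsilon|\epsilon^k$ ($k\ge0$ copies of $\epsilon$ after the bar), $b(\mathbf 1|\epsilon^k)=0$, $b(\epsilon|\epsilon^k)=0$ for $k<n$ and $\mathbf 1|\epsilon^{k-n}$ for $k\ge n$, $B(\mathbf 1|\epsilon^k)=0$, $B(\epsilon|\epsilon^k)=(k+1)\mathbf 1|\epsilon^{k+1}$. Its homology has basis $[\epsilon|\epsilon^k]$, $0\le k\le n-1$. **Graph operations.** Put $c(a_1,\dots,a_{k+1})=\langle\mu_k(a_1,\dots,a_k),a_{k+1}\rangle$,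 $\{e_s\}$ a basis of $A_n$ and $\{e^s\}$ its dual basis. - Mukai pairing: $\langle a_0|\cdots|a_i,b_0|\cdots|b_j\rangle_{\rm Muk}=\sum\pm c(a_{q+1},..,a_i,a_0,..,a_p,e_s,b_{p'+1},..,b_{q'},e_t)\,c(b_{q'+1},..,b_j,b_0,..,b_{p'},e^s,a_{p+1},..,a_q,e^t)$ over $0\le p\le q\le i$, $0\le p'\le q'\le j$, $s,t$. - Coproduct: $\Delta(a_0|\cdots|a_k)=\sum\pm c(a_{l+1},..,a_k,a_0,..,a_r,e_p,a_{s+1},..,a_t,e_q)\,(e^p|a_{r+1}|\cdots|a_s)\otimes(e^q|a_{t+1}|\cdots|a_l)$ over $0\le r\le s\le t\le l\le k$ and $p,q$. - For a ribbon graph $G$ with one face and one leg (''input'') and no output, $\rho(G)(a_0|\cdots|a_k)$ is the signed sum, over all ways of placing $a_1,\dots,a_k$ in order in the corners met when going once around the face starting from the leg, of the contraction along the edges (by $\sum_s e_s\otimes e^s$) of the tensors $c$ put at the vertices, with $a_0$ on the leg. Let $G_2$ be the trivalent genus-one graph with edges $x,y,z,w$ and vertices with cyclic orders $(\mathrm{leg},x,z)$, $(y,w,z)$, $(w,x,y)$, and $G_3$ the graph with edges $x,w$ and one vertex with cyclic order $(\mathrm{leg},x,w,x,w)$. These operations are the action of the Kontsevich-Soibelman/Costello PROP of ribbon graph chains on moduli of curves with parametrized boundaries; trivalent graphs are oriented so as to represent the positive generator (class of a point) of $H_0$ of the corresponding moduli space, and the action is compatible with gluing. **Splitting.** Lift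 $[\epsilon|\epsilon^k]$ ($0\le k\le n-1$) to $\widetilde{\epsilon|\epsilon^k}=\sum_{l\ge0}(-1)^lc_{k,l}\,\epsilon|\epsilon^{k+nl+l}u^l\in L[[u]]$, $c_{k,0}=1$, $c_{k,l}=\prod_{j=0}^{l-1}(k+1+j(n+1))$; these are $(b+uB)$-closed. **Deformed Fock module and invariants.** Let $\langle\alpha u^i,\beta u^j\rangle_{\rm hres}=(-1)^i\langle\alpha,\beta\rangle_{\rm Muk}u^{i+j}$ on $L((u))$. The Weyl algebra $\mathcal W$ is generated over $\mathbb K[[\lambda]]$ by $L((u))$ with differential $b+uB$ and graded commutation relations $[x,y]=\mathrm{Res}_{u=0}\langle x,y\rangle_{\rm hres}\,du$. The deformed Fock module is the quotient of $\mathcal W$ by the left ideal imposing, for every $\alpha=\alpha_0+\alpha_1u+\cdots\in L[[u]]$, the relation $$\alpha=\big(T_1(\alpha_0)+T_2(\alpha_1)+T_3(\alpha_0)\big)\lambda+O(\lambda^2),$$ where $T_1(\alpha_0)=\frac12\sum(u^{-1}\alpha')(u^{-1}\alpha'')$ if $\Delta(\alpha_0)=\sum\alpha'\otimes\alpha''$, $T_2(\alpha_1)=\frac1{24}\rho(G_2)(\alpha_1)$, $T_3(\alpha_0)=-\frac14\rho(G_3)(\alpha_0)$. (The $\lambda^{2g-2+m}$-terms come from moduli of genus $g$ curves with $m$ marked boundaries; the higher order terms play no role for types $(0,3)$ and $(1,1)$.) In homology the splitting identifies the module with polynomials in the classes $u^{-j}\,\widetilde{\epsilon|\epsilon^i}$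 ($j\ge1$, $0\le i\le n-1$) with coefficients in $\mathbb K[[\lambda]]$. Costello's invariant $\langle[\epsilon|\epsilon^i],[\epsilon|\epsilon^j],[\epsilon|\epsilon^k]\rangle_{0,3}^{A_n}$ is the coefficient of $\lambda$ in the constant (degree $0$ polynomial) term of the class of the product $\widetilde{\epsilon|\epsilon^i}\,\widetilde{\epsilon|\epsilon^j}\,\widetilde{\epsilon|\epsilon^k}$ in this module.
   Formalization: The relation α = λT(α)+O(λ²) is imposed only for (b+uB)-closed α, in the homology of the Weyl algebra (mod λ², with λα = 0 for all α in L[[u]]); imposed for every α in L[[u]], α = ε|ε^n forces λ = 0 mod λ² when n ≥ 2. *)

(* Defs.v *)
From HB Require Import structures.
From mathcomp Require Import all_boot all_order all_algebra.
From mathcomp Require Import finmap.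
From mathcomp Require Import all_classical.
From mathcomp Require Import monalg.

Set Implicit Arguments.
Unset Strict Implicit.
Unset Printing Implicit Defensive.

Import Order.TTheory GRing.Theory Num.Theory.

Local Open Scope ring_scope.

Definition linext (R : nzRingType) (X : choiceType) (M : lmodType R)
    (f : X -> M) (x : {malg R[X]}) : M :=
  \sum_(a <- msupp x) x@_a *: f a.

Lemma linext0 (R : nzRingType) (X : choiceType) (M : lmodType R) (f : X -> M) :
  linext f 0 = 0.
Proof. by rewrite /linext msupp0 big_nil. Qed.

(* A basis vector of A_n is encoded by its shifted parity: true is the unit
   (odd after the shift), false is epsilon (even after the shift). *)
Section Algebra.
Context (K : fieldType) (n : nat).

(* mu s b is the coefficient of b in mu_(size s)(s).  In the shifted
   convention mu_2(a, 1) = (-1)^|a| a with |a| the unshifted parity, whence the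
   sign in mu_2(epsilon, 1) = - epsilon. *)
Definition mu (s : seq bool) (b : bool) : K :=
  match s with
  | [:: true; y] => (b == y)%:R
  | [:: x; true] => - (b == x)%:R
  | _ => (b && (s == nseq n.+1 false))%:R / n.+1%:R
  end.

(* The pairing is antisymmetric in shifted conventions; with these signs the
   tensors cyc below are cyclically invariant in the Koszul sense. *)
Definition pairing (a b : bool) : K :=
  if a == b then 0 else if a then 1 else -1.

Definition cyc (s : seq bool) : K :=
  \sum_(b : bool) mu (take (size s).-1 s) b * pairing b (last false s).

(* The dual basis, normalised by <e_s, e^t> = delta_(s,t), is
   e^s = dual_coef s * e_(~~ s). *)
Definition dual_coef (s : bool) : K := if s then 1 else -1.

End Algebra.

(* Koszul signs.  A word is a sequence of pairs (rank, basis vector); ranks give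
   the position of the letter in the source order of the operation.  The sign
   is that of the permutation of the odd letters which sorts them by rank. *)
Fixpoint inversions (s : seq nat) : nat :=
  if s is x :: s' then (count (fun y => y < x) s' + inversions s')%N else 0%N.

Definition ksign (K : nzRingType) (w : seq (nat * bool)) : K :=
  (-1) ^+ inversions [seq x.1 | x <- w & x.2].

(* (a, k) stands for a|epsilon^k. *)
Definition chain : choiceType := (bool * nat)%type.

Definition slot (a : chain) (i : nat) : bool :=
  if i == 0%N then a.1 else false.

(* The letters a_l, ..., a_(r-1) of a chain whose a_0 has rank o. *)
Definition letters (o : nat) (a : chain) (l r : nat) : seq (nat * bool) :=
  [seq ((o + i)%N, slot a i) | i <- index_iota l r].

Section Operations.
Context (K : fieldType) (n : nat).

Definition chains := {malg K[chain]}.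

Definition hoch_b (x : chains) : chains :=
  linext (fun a : chain =>
    if a.1 || (a.2 < n)%N then 0 else << (true, (a.2 - n)%N) : chain >>) x.

Definition connes_B (x : chains) : chains :=
  linext (fun a : chain =>
    if a.1 then 0 else a.2.+1%:R *: << (true, a.2.+1) : chain >>) x.

Local Notation c w := (cyc K n [seq x.2 | x <- w]).

(* Source order: e_s, e^s, e_t, e^t, a_0, ..., a_i, b_0, ..., b_j. *)
Definition mukai_basis (a b : chain) : K :=
  let: i := a.2 in let: j := b.2 in
  \sum_(q < i.+1) \sum_(p < q.+1) \sum_(q' < j.+1) \sum_(p' < q'.+1)
  \sum_(s : bool) \sum_(t : bool)
    let: A := letters 4 a in let: B := letters (5 + i) b in
    let: w1 := A q.+1 i.+1 ++ A 0 p.+1 ++ (0%N, s)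
                 :: B p'.+1 q'.+1 ++ [:: (2%N, t)] in
    let: w2 := B q'.+1 j.+1 ++ B 0 p'.+1 ++ (1%N, ~~ s)
                 :: A p.+1 q.+1 ++ [:: (3%N, ~~ t)] in
    ksign K (w1 ++ w2) * dual_coef K s * dual_coef K t * c w1 * c w2.

Definition mukai (x y : chains) : K :=
  \sum_(a <- msupp x) \sum_(b <- msupp y) x@_a * y@_b * mukai_basis a b.

(* Source order: e_p, e^p, a_0, ..., a_k, e_q, e^q.  Having one edge on each
   side of the input makes the coproduct a map of complexes for hoch_b, with
   Delta(epsilon) = epsilon (x) epsilon. *)
Definition coproduct (x : chains) : {malg K[(chain * chain)%type]} :=
  linext (fun a : chain =>
    let: k := a.2 in
    \sum_(l < k.+1) \sum_(t < l.+1) \sum_(s < t.+1) \sum_(r < s.+1)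
    \sum_(p : bool) \sum_(q : bool)
      let: A := letters 2 a in
      let: w := A l.+1 k.+1 ++ A 0 r.+1 ++ (0%N, p)
                  :: A s.+1 t.+1 ++ [:: ((k + 3)%N, q)] in
      let: o1 := (1%N, ~~ p) :: A r.+1 s.+1 in
      let: o2 := ((k + 4)%N, ~~ q) :: A t.+1 l.+1 in
      (ksign K (w ++ o1 ++ o2) * dual_coef K p * dual_coef K q * c w) *:
        << ((~~ p, (s - r)%N), (~~ q, (l - t)%N)) : (chain * chain)%type >>) x.

(* A ribbon graph with one leg is given by the cyclic orders at its vertices.
   The leg is the half-edge 0 and the e-th edge (e >= 0) consists of the
   half-edges 2e+1 and 2e+2.  The numbering of the edges and of their ends is
   the orientation of the graph. *)
Definition other_half (h : nat) : nat := if odd h then h.+1 else h.-1.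

Definition next_half (G : seq (seq nat)) (h : nat) : nat :=
  next (nth [::] G (find (fun v => h \in v) G)) h.

(* The corner following h in the cyclic order is called the corner h; these are
   the corners met when going around the face from the leg. *)
Definition corners (G : seq (seq nat)) (m : nat) : seq nat :=
  traject (fun h => other_half (next_half G h)) 0%N m.*2.+1.

(* m is the number of edges; a_i (i > 0) is placed at the corner numbered
   f_(i-1).  Source order: half-edges 1, ..., 2m, then a_0, ..., a_k. *)
Definition ribbon_basis (G : seq (seq nat)) (m : nat) (a : chain) : K :=
  let: k := a.2 in
  \sum_(s : m.-tuple bool)
  \sum_(f : k.-tuple 'I_m.*2.+1 | sorted leq [seq val x | x <- f])
    let half h :=
      if h == 0%N then (m.*2.+1, a.1)
      else (h, if odd h then nth false s h./2 else ~~ nth false s h.-1./2) in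
    let placed h :=
      [seq ((m.*2.+1 + i)%N, slot a i) | i <- iota 1 k
         & nth 0%N (corners G m) (nth ord0 f i.-1) == h] in
    let word v := flatten [seq half h :: placed h | h <- v] in
    ksign K (flatten [seq word v | v <- G])
      * (\prod_(e < m) dual_coef K (tnth s e)) * \prod_(v <- G) c (word v).

Definition ribbon (G : seq (seq nat)) (m : nat) (x : chains) : K :=
  \sum_(a <- msupp x) x@_a * ribbon_basis G m a.

(* Edges in the order x, z, y, w.  With this orientation the operation agrees
   in homology with the gluing of the two outputs of the coproduct by the
   Mukai pairing, i.e. it represents the positive generator of H_0. *)
Definition G2 : seq (seq nat) :=
  [:: [:: 0; 1; 3]; [:: 5; 7; 4]; [:: 8; 2; 6]]%N.

(* Edges in the order x, w. *)
Definition G3 : seq (seq nat) := [:: [:: 0; 1; 3; 2; 4]]%N.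

(* Laurent series in u with coefficients in the chains. *)
Definition laurent_pred : {pred (int -> chains)} :=
  fun x => `[< exists N : int, forall i : int, (i < N)%R -> x i = 0 >].

Record laurent := Laurent {
  lcoef :> int -> chains;
  laurentP : lcoef \in laurent_pred }.

HB.instance Definition _ := [isSub for lcoef].
HB.instance Definition _ := [Choice of laurent by <:].

Lemma laurent_submod : submod_closed laurent_pred.
Proof.
split=> [|a x y /asboolP[M hM] /asboolP[N hN]]; apply/asboolP.
  by exists 0.
exists (Order.min M N) => i; rewrite lt_min => /andP[iM iN].
by rewrite /GRing.add /= /GRing.scale /= hM // hN // scaler0 addr0.
Qed.

HB.instance Definition _ :=
  GRing.isSubmodClosed.Build K (int -> chains) laurent_pred laurent_submod.
HB.instance Definition _ := [SubChoice_isSubLmodule of laurent by <:].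

Lemma laurent_diff_subproof (x : laurent) :
  (fun i : int => hoch_b (x i) + connes_B (x (i - 1))) \in laurent_pred.
Proof.
have /asboolP[N hN] := laurentP x; apply/asboolP; exists N => i iN /=.
rewrite !hN //; first by rewrite /hoch_b /connes_B !linext0 addr0.
by rewrite ltrBlDr ltr_wpDr.
Qed.

(* The differential b + uB. *)
Definition laurent_diff (x : laurent) : laurent :=
  Laurent (laurent_diff_subproof x).

Lemma laurent_sign_subproof (x : laurent) :
  (fun i : int => linext (fun a : chain => (-1) ^+ a.1 *: << a >>) (x i))
    \in laurent_pred.
Proof.
have /asboolP[N hN] := laurentP x; apply/asboolP; exists N => i /hN /= ->.
exact: linext0.
Qed.

(* x |-> (-1)^|x| x *)
Definition laurent_sign (x : laurent) : laurent :=
  Laurent (laurent_sign_subproof x).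

Lemma laurent_shift_subproof (m : int) (x : laurent) :
  (fun i : int => x (i - m)) \in laurent_pred.
Proof.
have /asboolP[N hN] := laurentP x; apply/asboolP; exists (N + m) => i iN /=.
by rewrite hN // ltrBlDr.
Qed.

(* u^m x *)
Definition laurent_shift (m : int) (x : laurent) : laurent :=
  Laurent (laurent_shift_subproof m x).

Lemma laurent_series_subproof (f : nat -> chains) :
  (fun i : int => if i is Posz l then f l else 0) \in laurent_pred.
Proof. by apply/asboolP; exists 0 => -[]. Qed.

(* sum_(l >= 0) f l u^l *)
Definition laurent_series (f : nat -> chains) : laurent :=
  Laurent (laurent_series_subproof f).

Definition laurent_const (x : chains) : laurent :=
  laurent_series (fun l => if l == 0%N then x else 0).

(* Membership in L[[u]]. *)
Definition nonneg (x : laurent) : Prop := forall i : int, (i < 0)%R -> x i = 0.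

Definition homogeneous (p : bool) (x : laurent) : Prop :=
  forall (i : int) (a : chain), (x i)@_a != 0 -> a.1 = p.

(* Res_(u=0) <x, y>_hres du; the sum has finite support. *)
Definition residue_pairing (x y : laurent) : K :=
  \sum_(i \in [set: int]) (-1) ^ i * mukai (x i) (y (- 1 - i)).

Definition lift_coef (k l : nat) : K :=
  \prod_(j < l) (k + 1 + j * n.+1)%:R.

Definition lift_class (k : nat) : laurent :=
  laurent_series (fun l =>
    ((-1) ^+ l * lift_coef k l) *: << (false, (k + n * l + l)%N) : chain >>).

(* The free algebra on L((u)) over K[lambda].  Everything below is modulo
   lambda^2, where K[lambda] and K[[lambda]] agree. *)
Definition free_algebra := {malg {poly K}[{fmonom laurent}]}.

Definition gen (x : laurent) : free_algebra := << fmu x >>.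

Local Notation lambda := ('X : {poly K}).

Fixpoint word_diff (s : seq laurent) : free_algebra :=
  if s is x :: s' then
    gen (laurent_diff x) * \prod_(y <- s') gen y
      + gen (laurent_sign x) * word_diff s'
  else 0.

(* The differential of the free algebra: the odd derivation extending b+uB. *)
Definition weyl_diff (w : free_algebra) : free_algebra :=
  linext (fun m : {fmonom laurent} => word_diff m) w.

(* The Weyl algebra is the quotient of the free algebra by the two-sided ideal
   weyl_zero; the first relation makes gen linear over K. *)
Inductive weyl_zero : free_algebra -> Prop :=
| weyl_zero0 : weyl_zero 0
| weyl_zeroD v w : weyl_zero v -> weyl_zero w -> weyl_zero (v + w)
| weyl_zeroM v w r : weyl_zero w -> weyl_zero (v * w * r)
| weyl_linear a x y :
    weyl_zero (gen (a *: x + y) - (a%:P *: gen x + gen y))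
| weyl_commutator p q x y : homogeneous p x -> homogeneous q y ->
    weyl_zero (gen x * gen y - (-1) ^+ (p && q) *: (gen y * gen x)
                 - (residue_pairing x y)%:P *: 1).

Definition weyl_cycle (w : free_algebra) : Prop := weyl_zero (weyl_diff w).

Definition fock_T1 (a0 : chains) : free_algebra :=
  (2%:R^-1)%:P *: \sum_(a <- msupp (coproduct a0))
    ((coproduct a0)@_a)%:P *:
      (gen (laurent_shift (-1) (laurent_const << a.1 >>))
         * gen (laurent_shift (-1) (laurent_const << a.2 >>))).

Definition fock_T2 (a1 : chains) : K := 24%:R^-1 * ribbon G2 4 a1.

Definition fock_T3 (a0 : chains) : K := - 4%:R^-1 * ribbon G3 2 a0.

Definition fock_T (x : laurent) : free_algebra :=
  fock_T1 (x 0) + (fock_T2 (x 1) + fock_T3 (x 0))%:P *: 1.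

(* fock_zero w: modulo lambda^2, w vanishes in the quotient of the homology of
   the Weyl algebra by the left ideal imposing x = lambda T(x) for the (classes
   of) closed x in L[[u]].  The element T(x) is closed only in the undeformed
   Fock module, so its class is taken there: multiples of lambda are considered
   modulo the chain-level relations lambda x = 0, for all x in L[[u]].
   The relation x = lambda T(x) cannot be imposed on non-closed x: let n >= 2,
   e_k = epsilon|epsilon^k and x = e_n.  Then x commutes with every element, so
   e_0 e_(n-2) x = x e_0 e_(n-2) vanishes modulo lambda^2, while
   lambda e_0 e_(n-2) T(x) = lambda because of the terms e_s (x) e_(n-s),
   s = 1, n-1, of Delta(x); hence lambda would be 0. *)
Inductive fock_zero : free_algebra -> Prop :=
| fock_zero_weyl w : weyl_zero w -> fock_zero w
| fock_zeroD v w : fock_zero v -> fock_zero w -> fock_zero (v + w)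
| fock_boundary w : fock_zero (weyl_diff w)
| fock_relation w x : weyl_cycle w -> nonneg x -> laurent_diff x = 0 ->
    fock_zero (w * (gen x - lambda *: fock_T x))
| fock_lambda w x : nonneg x -> fock_zero (lambda *: (w * gen x))
| fock_lambda2 w : fock_zero (lambda ^+ 2 *: w).

(* Polynomials in the classes of u^(-j-1) lift_class i, for j >= 0 and i < n. *)
Definition fock_poly := {malg {poly K}[{cmonom (nat * 'I_n)%type}]}.

Definition fock_class (P : fock_poly) : free_algebra :=
  linext (fun m : {cmonom (nat * 'I_n)%type} => \prod_(v <- finsupp m)
    gen (laurent_shift (- v.1.+1%:Z) (lift_class v.2)) ^+ m v) P.

Definition fock_represents (P : fock_poly) (w : free_algebra) : Prop :=
  fock_zero (w - fock_class P).

(* v is the coefficient of lambda in the constant term of the class of w. *)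
Definition lambda_coef (w : free_algebra) (v : K) : Prop :=
  (exists P : fock_poly, fock_represents P w) /\
  (forall P : fock_poly, fock_represents P w ->
     (P@_(mone : {cmonom (nat * 'I_n)%type}) : {poly K})`_1 = v).

Definition costello_03 (i j k : 'I_n) (v : K) : Prop :=
  lambda_coef (gen (lift_class i) * gen (lift_class j) * gen (lift_class k)) v.

End Operations.

(* Main.v *)
From HB Require Import structures.
Require Import Defs.
From mathcomp Require Import all_boot all_order all_algebra.
From mathcomp Require Import finmap all_classical monalg.
From mathcomp Require Import zify ring.

(** The Mukai pairing has a large radical: it contains every chain starting with
    the unit, hence the images of b and B, and every epsilon|epsilon^k with
    k >= n. On the chains epsilon|epsilon^k with k < n it is 1 if the exponents
    add up to n-1 and 0 otherwise (mukaiE). So only these chains are visible in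
    commutators, and every term of a boundary contains an invisible letter.

    By Wick's theorem the Weyl algebra then has a functional (vacuum) that is
    compatible with the commutation relations, kills all boundaries, every
    product ending in L[[u]] and every product beginning with a letter without
    visible terms in degrees at least zero, and takes the value 1 at 1. It reads
    off the constant term in the undeformed Fock module.

    To first order in lambda the deformed module is obtained from the same
    functional by replacing the vacuum |0> with exp(lambda S)|0>, where the
    potential S is a polynomial in the letters u^-1 epsilon|epsilon^k and
    u^-2 epsilon|epsilon^k such that commuting a closed x in L[[u]] past S gives
    T(x) (vacuum_potential). Such an S exists because the coproduct is
    Delta(epsilon|epsilon^k) = sum over s+t=k of epsilon|epsilon^s (x)
    epsilon|epsilon^t modulo radical terms (coproduct_eps), which corresponds to
    a totally symmetric tensor, and because the genus one terms are scalars that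
    depend linearly on the class of x (fock_scalarE), so that linear terms in S
    account for them.
    The coefficient of lambda in this deformed expectation value vanishes on all
    relations (lambda_constant_term_fock_zero) and picks the right coefficient of
    any representing polynomial (lambda_constant_term_fock_class). This is the
    uniqueness of the invariant.

    For existence, the relation for the third class turns the product of the
    three classes into lambda times words in the first two classes and the
    outputs of the coproduct of the third one. Moving the two classes to the
    right, where they vanish, leaves the scalar
      1/2 sum over s+t=k of (<j,s> <i,t> + <j,t> <i,s>),
    which is 1 if i+j+k = 2n-2 and 0 otherwise (three_classes,
    three_point_value). *)

Set Implicit Arguments.
Unset Strict Implicit.
Unset Printing Implicit Defensive.

Import Order.TTheory GRing.Theory Num.Theory.
Local Open Scope ring_scope.

(** * Linear extensions *)

Section LinearExtension.
Context (R : nzRingType) (X : choiceType) (M : lmodType R) (f : X -> M).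

Lemma linextEw (d : {fset X}) (x : {malg R[X]}) :
  fsubset (msupp x) d -> linext f x = \sum_(a <- d) x@_a *: f a.
Proof.
move=> le; rewrite /linext; apply: big_fset_incl le _ => a _ /mcoeff_outdom ->.
by rewrite scale0r.
Qed.

Lemma linext_linear : linear (linext f).
Proof.
move=> c x y; pose d := fsetU (msupp x) (msupp y).
have xd : fsubset (msupp x) d by exact: fsubsetUl.
have yd : fsubset (msupp y) d by exact: fsubsetUr.
have zd : fsubset (msupp (c *: x + y)) d.
  apply/fsubsetP => a; rewrite -mcoeff_neq0 mcoeffD mcoeffZ in_fsetU.
  by case: (msuppP x); case: (msuppP y) => //=; rewrite mulr0 addr0 eqxx.
rewrite !(linextEw (d := d)) // scaler_sumr -big_split; apply: eq_bigr => a _ /=.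
by rewrite mcoeffD mcoeffZ scalerDl scalerA.
Qed.

HB.instance Definition _ :=
  GRing.isLinear.Build R {malg R[X]} M _ (linext f) linext_linear.

Lemma linextU a : linext f << a >> = f a.
Proof. by rewrite (linextEw msuppU_le) big_seq_fset1 mcoeffUU scale1r. Qed.

Lemma linextZU c a : linext f (c *: << a >>) = c *: f a.
Proof. by rewrite linearZ /= linextU. Qed.

Lemma malg_basis (x : {malg R[X]}) : x = \sum_(a <- msupp x) x@_a *: << a >>.
Proof.
rewrite {1}[x]monalgE; apply: eq_bigr => a _; apply/malgP => b.
by rewrite mcoeffZ !mcoeffU mulr_natr.
Qed.

(** Sums over the support of a chain are thus compared with sums over the
    finitely many basis chains that contribute. *)
Lemma linext_supp (I : finType) (h : I -> X) (x : {malg R[X]}) :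
    injective h -> (forall a, (forall i, a != h i) -> x@_a *: f a = 0) ->
  linext f x = \sum_i x@_(h i) *: f (h i).
Proof.
move=> h_inj f0; pose d := fsetU (msupp x) (seq_fset tt (codom h)).
rewrite (linextEw (d := d)) ?fsubsetUl //.
rewrite (bigID (fun a => a \in codom h)) /= [X in _ + X]big1 ?addr0 => [|a]; last first.
  move=> /negP ha; apply: f0 => i; apply/eqP => ai; apply: ha.
  by rewrite ai codom_f.
rewrite -big_filter -[RHS](big_map h xpredT (fun a => x@_a *: f a)).
apply: perm_big; apply: uniq_perm; rewrite ?filter_uniq ?fset_uniq //.
  by rewrite map_inj_uniq // index_enum_uniq.
move=> a; rewrite mem_filter in_fsetU seq_fsetE.
rewrite (_ : (a \in [seq h i | i <- index_enum I]) = (a \in codom h)).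
  by case: (a \in codom h); rewrite ?orbT.
by apply/mapP/codomP => [[i _ ->]|[i ->]]; exists i => //; rewrite mem_index_enum.
Qed.

Lemma linext_pick (I : finType) (h : I -> X) (x : {malg R[X]}) :
    injective h -> (forall a, (forall i, a != h i) -> f a = 0) ->
  linext f x = \sum_i x@_(h i) *: f (h i).
Proof. by move=> h_inj f0; apply: linext_supp => // a /f0 ->; rewrite scaler0. Qed.

Lemma linext_single (x : {malg R[X]}) (b : X) :
  (forall a, a != b -> f a = 0) -> linext f x = x@_b *: f b.
Proof.
move=> f0; rewrite (@linext_pick unit (fun=> b)) => [||a na].
- by rewrite big_const card_unit /= addr0.
- by case=> [[]].
- exact/f0/(na tt).
Qed.

End LinearExtension.

(** * Wick's theorem *)

Section Wick.
Context (T : Type) (K : comNzRingType) (P : T -> T -> K).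
Implicit Types (s u v : seq T) (g : seq T -> K) (x y z : T).

(** The word left over by a contraction is fed to a functional g rather than
    returned, which keeps the recursion of pairings structural. *)
Fixpoint contract x g s : K :=
  if s is y :: s' then P x y * g s' + contract x (fun s'' => g (y :: s'')) s'
  else 0.

(** The sum over the perfect matchings of a word with r pairs: the first letter
    is contracted with each of the others in turn. *)
Fixpoint pairings r s : K :=
  match r, s with
  | 0, _ => (nilp s)%:R
  | r'.+1, x :: s' => contract x (pairings r') s'
  | _, [::] => 0
  end.

Definition wick s : K := pairings (size s)./2 s.

Lemma eq_contract x g h : g =1 h -> contract x g =1 contract x h.
Proof.
by move=> gh s; elim: s g h gh => //= y s IHs g h gh; rewrite gh (IHs _ _ (fun s' => gh (y :: s'))).
Qed.

Lemma contract_linear x (a : K) g h s :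
  contract x (fun s => a * g s + h s) s = a * contract x g s + contract x h s.
Proof.
elim: s g h => [|y s IHs] g h /=; first by rewrite mulr0 addr0.
by rewrite IHs; ring.
Qed.

Lemma contract0 x s : contract x (fun=> 0) s = 0.
Proof. by elim: s => //= y s ->; rewrite mulr0 addr0. Qed.

Lemma contract_swap x y g s :
  contract x (contract y g) s = contract y (contract x g) s.
Proof.
elim: s g => //= z s IHs g.
by rewrite !contract_linear IHs; ring.
Qed.

(** If z is contracted with neither x nor y the relation for g applies, and the
    terms where it is contracted with one of them agree on both sides. *)
Lemma contract_exchange (c : K) g g' x y :
    (forall u v, g (u ++ x :: y :: v) = g (u ++ y :: x :: v) + c * g' (u ++ v)) ->
  forall z u v, contract z g (u ++ x :: y :: v) =
    contract z g (u ++ y :: x :: v) + c * contract z g' (u ++ v).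
Proof.
move=> gP z u v; elim: u g g' gP => [|w u IHu] g g' gP /=; last first.
  rewrite gP (IHu _ (fun s => g' (w :: s))) => [|u' v']; last exact: (gP (w :: u')).
  ring.
rewrite (@eq_contract z _ (fun s => c * g' s + g (y :: x :: s))) => [|s]; last first.
  by rewrite (gP [::]) addrC.
by rewrite contract_linear; ring.
Qed.

(** Two neighbours are either contracted with each other, in the order of the
    word, or with two other letters, and then their order is irrelevant. *)
Lemma pairings_exchange x y r u v :
  pairings r.+1 (u ++ x :: y :: v) =
  pairings r.+1 (u ++ y :: x :: v) + (P x y - P y x) * pairings r (u ++ v).
Proof.
elim: r u v => [|r IHr] [|z u] v.
- rewrite /= /nilp /= !contract0; ring.
- rewrite /= mulr0 addr0 -[RHS]addr0 -[X in _ + X](mulr0 0) -{2}(contract0 z (u ++ v)).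
  by apply: contract_exchange => [[|? ?] ?]; rewrite mulr0 addr0.
- rewrite /= -/pairings (contract_swap x y); ring.
- exact: contract_exchange IHr _ _ _.
Qed.

Lemma wick_exchange x y u v :
  wick (u ++ x :: y :: v) =
  wick (u ++ y :: x :: v) + (P x y - P y x) * wick (u ++ v).
Proof.
rewrite /wick (_ : (size (u ++ x :: y :: v))./2 = (size (u ++ v))./2.+1); last first.
  by rewrite !size_cat /= !addnS.
rewrite (_ : (size (u ++ y :: x :: v))./2 = (size (u ++ v))./2.+1); last first.
  by rewrite !size_cat /= !addnS.
exact: pairings_exchange.
Qed.

(** A linear relation between the letters that may fill one slot of a word
    passes to contractions, hence to sums over pairings. *)
Lemma contract_slot g (a : K) x y z :
    (forall w, P w z = a * P w x + P w y) ->
    (forall u v, g (u ++ z :: v) = a * g (u ++ x :: v) + g (u ++ y :: v)) ->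
  forall w u v, contract w g (u ++ z :: v) =
    a * contract w g (u ++ x :: v) + contract w g (u ++ y :: v).
Proof.
move=> Pz gz w u v; elim: u g gz => [|t u IHu] g gz /=.
  by rewrite (@eq_contract w _ _ (gz [::])) contract_linear Pz; ring.
rewrite gz (IHu (fun s => g (t :: s))) => [|u' v']; last exact: (gz (t :: u')).
ring.
Qed.

Lemma contract_linearl (a : K) g x y z s :
  (forall w, P z w = a * P x w + P y w) ->
  contract z g s = a * contract x g s + contract y g s.
Proof.
move=> Pz; elim: s g => [|w s IHs] g /=; first by rewrite mulr0 addr0.
by rewrite Pz IHs; ring.
Qed.

Lemma pairings_slot (a : K) x y z :
    (forall w, P w z = a * P w x + P w y) ->
    (forall w, P z w = a * P x w + P y w) ->
  forall r u v, pairings r.+1 (u ++ z :: v) =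
    a * pairings r.+1 (u ++ x :: v) + pairings r.+1 (u ++ y :: v).
Proof.
move=> zl zr; elim=> [|r IHr] [|w u] v.
- exact: contract_linearl.
- by apply: contract_slot => // u' v'; case: u' => *; rewrite mulr0 addr0.
- exact: contract_linearl.
- exact: contract_slot.
Qed.

Lemma wick_slot (a : K) x y z :
    (forall w, P w z = a * P w x + P w y) ->
    (forall w, P z w = a * P x w + P y w) ->
  forall u v, wick (u ++ z :: v) = a * wick (u ++ x :: v) + wick (u ++ y :: v).
Proof.
move=> zl zr u v; rewrite /wick !size_cat /=.
case E: ((size u + (size v).+1)./2) => [|r]; last exact: pairings_slot.
by case: u v {E} => [|? ?] [|? ?]; rewrite /= ?mulr0 ?addr0.
Qed.

Lemma pairings_last x r u :
  (forall w, P w x = 0) -> pairings r (rcons u x) = 0.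
Proof.
move=> Px; elim: r u => [|r IHr] [|w u] //=.
have D g : (forall u, g (rcons u x) = 0) -> contract w g (rcons u x) = 0.
  elim: u g => [|t u IHu] g g0 /=; first by rewrite Px mul0r addr0.
  by rewrite g0 (IHu (fun s => g (t :: s))) => [|u']; rewrite ?mulr0 ?addr0 // -?rcons_cons.
exact: D.
Qed.

Lemma wick_last x u : (forall w, P w x = 0) -> wick (rcons u x) = 0.
Proof. exact: pairings_last. Qed.

Lemma wick_head x s : (forall w, P x w = 0) -> wick (x :: s) = 0.
Proof.
move=> Px; rewrite /wick; case: (_./2) => //= r.
by elim: s (pairings r) => //= y s IHs g; rewrite Px mul0r add0r IHs.
Qed.

End Wick.

(** * Vacuum expectation values *)

Section MonoidAlgebra.
Context (M : monomType) (R : comNzRingType).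
Implicit Types (v w : {malg R[M]}).

Lemma malg_mulU (m m' : M) : << m >> * << m' >> = << mmul m m' >> :> {malg R[M]}.
Proof. by rewrite malgM_def fgmulUU mulr1. Qed.

Lemma malg_scalerAr (c : R) v w : v * (c *: w) = c *: (v * w).
Proof.
rewrite -!mul_malgC mulrA [RHS]mulrA; congr (_ * w).
rewrite !malgM_def fgmulUg fgmulgU; apply: eq_bigr => k _.
by rewrite mulm1 mul1m mulrC.
Qed.

Lemma malg_scalerAl (c : R) v w : (c *: v) * w = c *: (v * w).
Proof. by rewrite -scalerAl. Qed.

Lemma malg_combl (c : R) (m v w r : {malg R[M]}) :
  (c *: m + v) * w * r = c *: (m * w * r) + v * w * r.
Proof. by rewrite !mulrDl !malg_scalerAl. Qed.

Lemma malg_combr (c : R) (m v w r : {malg R[M]}) :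
  r * w * (c *: m + v) = c *: (r * w * m) + r * w * v.
Proof. by rewrite mulrDr malg_scalerAr. Qed.

Lemma malg_ind (Q : {malg R[M]} -> Prop) :
    Q 0 -> (forall c m w, Q w -> Q (c *: << m >> + w)) -> forall w, Q w.
Proof.
by move=> Q0 QD w; rewrite [w]malg_basis; apply: big_rec => // m w' _; apply: QD.
Qed.

(** Linearity of a functional is a hypothesis in terms of values, so that it can
    be applied to functionals such as w |-> f (v * w * r). *)
Lemma functional_eq0 (f : {malg R[M]} -> R) :
    (forall a v w, f (a *: v + w) = a * f v + f w) ->
  (forall m, f << m >> = 0) -> forall v, f v = 0.
Proof.
move=> fl f0 v; elim/malg_ind: v => [|a m w IHw].
  by apply: (addrI (f 0)); rewrite addr0 -[X in X + _]mul1r -fl scaler0 addr0.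
by rewrite fl IHw f0 mulr0 addr0.
Qed.

Lemma functional_mulr (f : {malg R[M]} -> R) (A : {malg R[M]}) :
    (forall a v w, f (a *: v + w) = a * f v + f w) ->
  forall a v w, f ((a *: v + w) * A) = a * f (v * A) + f (w * A).
Proof. by move=> fl a v w; rewrite mulrDl malg_scalerAl fl. Qed.

Lemma functional_mull (f : {malg R[M]} -> R) (A : {malg R[M]}) :
    (forall a v w, f (a *: v + w) = a * f v + f w) ->
  forall a v w, f (A * (a *: v + w)) = a * f (A * v) + f (A * w).
Proof. by move=> fl a v w; rewrite mulrDr malg_scalerAr fl. Qed.

Definition bilinear (F : {malg R[M]} -> {malg R[M]} -> R) : Prop :=
  (forall a m v r, F (a *: m + v) r = a * F m r + F v r) /\
  (forall a m v r, F r (a *: m + v) = a * F r m + F r v).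

Lemma bilinear_ext F G : bilinear F -> bilinear G ->
  (forall m m', F << m >> << m' >> = G << m >> << m' >>) ->
  forall v r, F v r = G v r.
Proof.
move=> [Fl Fr] [Gl Gr] FG v r.
have F0 s : F s 0 = 0.
  by apply: (addrI (F s 0)); rewrite addr0 -[X in X + _]mul1r -Fr scaler0 addr0.
have G0 s : G s 0 = 0.
  by apply: (addrI (G s 0)); rewrite addr0 -[X in X + _]mul1r -Gr scaler0 addr0.
have F0' s : F 0 s = 0.
  by apply: (addrI (F 0 s)); rewrite addr0 -[X in X + _]mul1r -Fl scaler0 addr0.
have G0' s : G 0 s = 0.
  by apply: (addrI (G 0 s)); rewrite addr0 -[X in X + _]mul1r -Gl scaler0 addr0.
elim/malg_ind: v => [|a m v IHv]; first by rewrite F0' G0'.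
rewrite Fl Gl IHv; congr (_ * _ + _).
elim/malg_ind: r {IHv} => [|b m' r IHr]; first by rewrite F0 G0.
by rewrite Fr Gr IHr FG.
Qed.

Lemma bilinear_sandwich (f : {malg R[M]} -> R) (A : {malg R[M]}) :
    (forall a v w, f (a *: v + w) = a * f v + f w) ->
  bilinear (fun v r => f (v * A * r)).
Proof. by move=> fl; split=> a m v r; rewrite (malg_combl, malg_combr) fl. Qed.

Lemma bilinear_comb F G (c : R) : bilinear F -> bilinear G ->
  bilinear (fun v r => F v r + c * G v r).
Proof.
by move=> [Fl Fr] [Gl Gr]; split=> a m v r; rewrite ?Fl ?Gl ?Fr ?Gr; ring.
Qed.

End MonoidAlgebra.

Section Vacuum.
Context (T : choiceType) (R : comNzRingType) (P : T -> T -> R).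
Local Notation free := {malg R[{fmonom T}]}.
Implicit Types (v w r : free) (x y z : T).

Local Notation g x := (<< fmu x >> : free).

(** Locked, as its values on words and its linearity are all that is used. *)
Definition vac : free -> R :=
  locked (fun w => linext (fun m : {fmonom T} => wick P m : R^o) w).

Lemma vac_scalar : scalar vac.
Proof. by move=> a v w; rewrite /vac -lock linext_linear. Qed.

Lemma vacU (m : {fmonom T}) : vac << m >> = wick P m.
Proof. by rewrite /vac -lock linextU. Qed.

Lemma vac_word (m k m' : {fmonom T}) :
  vac (<< m >> * << k >> * << m' >>) = wick P (m ++ k ++ m').
Proof.
rewrite (malg_mulU R m k) (malg_mulU R (mmul m k) m') vacU.
by rewrite !fmM catA.
Qed.

(** Identities between expectation values are multilinear, so it suffices to
    check them on words. *)
Lemma vac_ext (A B : free) (c : R) (C : free) :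
    (forall m m' : {fmonom T}, vac (<< m >> * A * << m' >>) =
       vac (<< m >> * B * << m' >>) + c * vac (<< m >> * C * << m' >>)) ->
  forall v r, vac (v * A * r) = vac (v * B * r) + c * vac (v * C * r).
Proof.
apply: bilinear_ext; first exact: bilinear_sandwich vac_scalar.
by apply: bilinear_comb; apply: bilinear_sandwich vac_scalar.
Qed.

Lemma vac_ext_word (c : R) (k k1 k2 : {fmonom T}) :
    (forall u s, wick P (u ++ k ++ s) =
       wick P (u ++ k1 ++ s) + c * wick P (u ++ k2 ++ s)) ->
  forall v r,
    vac (v * << k >> * r) = vac (v * << k1 >> * r) + c * vac (v * << k2 >> * r).
Proof.
move=> E; apply: vac_ext => m m'.
apply: etrans (vac_word m k m') _; apply: etrans (E m m') _.
by congr (_ + _ * _); apply/esym/vac_word.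
Qed.

Lemma vac_exchange v r x y :
  vac (v * (g x * g y) * r) =
  vac (v * (g y * g x) * r) + (P x y - P y x) * vac (v * r).
Proof.
have E := @vac_ext_word (P x y - P y x) (mmul (fmu x) (fmu y))
  (mmul (fmu y) (fmu x)) mone _ v r.
have gg a b : << mmul (fmu a) (fmu b) >> = g a * g b := esym (malg_mulU R _ _).
rewrite (gg x y) (gg y x) in E.
apply: etrans (E _) _ => [u s|]; first by rewrite !fmM !fmU fm1; exact: wick_exchange.
by congr (_ + _ * vac (_ * r)); exact: mulr1.
Qed.

Lemma vac_linear (a : R) x y z :
    (forall t, P t z = a * P t x + P t y) ->
    (forall t, P z t = a * P x t + P y t) ->
  forall v r, vac (v * g z * r) = a * vac (v * g x * r) + vac (v * g y * r).
Proof.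
move=> zl zr v r; rewrite addrC; apply: vac_ext_word => s t.
by rewrite !fmU addrC; exact: wick_slot.
Qed.

(** The slot filled by x is additive in x and x = x + x as far as pairings are
    concerned. *)
Lemma vac_null x :
  (forall t, P t x = 0) -> (forall t, P x t = 0) ->
  forall v r, vac (v * g x * r) = 0.
Proof.
move=> xl xr v r; apply: (addIr (vac (v * g x * r))); rewrite add0r.
apply: etrans (esym (@vac_linear 1 x x x _ _ v r)) => [|t|t]; last 2 first.
- by rewrite xl mulr0 addr0.
- by rewrite xr mulr0 addr0.
by rewrite mul1r.
Qed.

Lemma vac_last x : (forall z, P z x = 0) -> forall v, vac (v * g x) = 0.
Proof.
move=> xl; apply: functional_eq0; first exact: functional_mulr vac_scalar.
move=> m; apply: etrans (congr1 vac (malg_mulU R m (fmu x))) _.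
by rewrite vacU fmM fmU cats1 wick_last.
Qed.

Lemma vac_head x : (forall z, P x z = 0) -> forall v, vac (g x * v) = 0.
Proof.
move=> xl; apply: functional_eq0; first exact: functional_mull vac_scalar.
move=> m; apply: etrans (congr1 vac (malg_mulU R (fmu x) m)) _.
by rewrite vacU fmM fmU wick_head.
Qed.

Lemma vac1 : vac 1 = 1.
Proof. by apply: etrans (vacU mone) _; rewrite fm1. Qed.

End Vacuum.

(** * The cyclic tensors *)

Section Cyclic.
Context (K : fieldType) (n : nat).
Local Notation cyc := (cyc K n).

(** The unit enters only the binary products and leaves only mu_(n+1), whose other
    letters are all epsilon and which is then paired with epsilon. *)
Lemma cyc_unit (s : seq bool) : true \in s -> size s != 3%N -> cyc s = 0.
Proof.
move=> ts s3; rewrite /cyc; apply: big1 => b _.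
have [/eqP|mu0] := eqVneq (mu K n (take (size s).-1 s) b) 0.
  by move=> /eqP ->; rewrite mul0r.
suff [-> l0] : b = true /\ last false s = true by rewrite l0 /pairing mulr0.
have [x s'E] : exists x, s = rcons (take (size s).-1 s) x.
  case: (lastP s) ts => // s' x _; exists x.
  by rewrite size_rcons /= -!cats1 take_size_cat.
move: mu0; set s' := take _ s in s'E *.
have s2 : size s' != 2%N by move: s3; rewrite s'E size_rcons.
have -> : mu K n s' b = (b && (s' == nseq n.+1 false))%:R / n.+1%:R.
  by case: s' s2 {s'E} => [|[] [|[] [|? ?]]].
have [s'n|_] := eqVneq s' (nseq n.+1 false); last by rewrite andbF mul0r eqxx.
case: b => [_|]; last by rewrite mul0r eqxx.
split=> //; rewrite s'E last_rcons.
by move: ts; rewrite s'E s'n mem_rcons inE mem_nseq andbF orbF => /eqP.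
Qed.

Lemma cyc_ttf : cyc [:: true; true; false] = 1.
Proof. by rewrite /cyc big_bool /= /pairing /= mul0r addr0 mulr1. Qed.

Lemma cyc_tft : cyc [:: true; false; true] = -1.
Proof. by rewrite /cyc big_bool /= /pairing /= mul0r add0r mul1r. Qed.

Lemma cyc_ftt : cyc [:: false; true; true] = 1.
Proof. by rewrite /cyc big_bool /= /pairing /= oppr0 mul0r add0r mulrNN mulr1. Qed.

Lemma cyc_counit : (0 < n)%N -> cyc (nseq n.+2 false) = n.+1%:R^-1.
Proof.
move=> n0; rewrite /cyc size_nseq -[n.+2.-1]/n.+1 take_nseq // big_bool.
have muE b : mu K n (nseq n.+1 false) b = b%:R / n.+1%:R.
  by case: n n0 => [|[|m]] //= _; rewrite eqxx andbT.
have -> m : last false (nseq m false) = false by elim: m.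
by rewrite !muE /pairing /= mul0r mul0r addr0 mul1r mulr1.
Qed.

Lemma cyc_eps (s : seq bool) :
  true \notin s -> size s != n.+2 -> cyc s = 0.
Proof.
move=> ts sn; rewrite /cyc; apply: big1 => b _.
have sE : s = nseq (size s) false.
  by apply/all_pred1P/allP => -[] //= /(negP ts).
rewrite sE size_nseq; case: (size s) sn => [|m]; first by rewrite /= andbF !mul0r.
rewrite eqSS => mn; rewrite -[m.+1.-1]/m take_nseq //.
have -> : mu K n (nseq m false) b = (b && (nseq m false == nseq n.+1 false))%:R / n.+1%:R.
  by case: m {mn} => [|[|[|m]]].
suff /negPf -> : nseq m false != nseq n.+1 false by rewrite andbF !mul0r.
by apply: contra mn => /eqP/(congr1 size); rewrite !size_nseq => ->.
Qed.

(** The operations and the pairing being odd, the tensors are even. *)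
Lemma cyc_parity (s : seq bool) : odd (count id s) -> cyc s = 0.
Proof.
have [s3|s3] := eqVneq (size s) 3%N; last first.
  have [ts _|ts] := boolP (true \in s); first exact: cyc_unit.
  by rewrite (@eq_in_count _ _ pred0) ?count_pred0 // => -[] // /(negP ts).
case: s s3 => [|x [|y [|z []]]] //= _.
case: x; case: y; case: z => //= _; rewrite /cyc big_bool /= /pairing /=;
  by rewrite ?(mulr0, mul0r, addr0, oppr0).
Qed.

End Cyclic.

Lemma size_letters o a l r : size (letters o a l r) = (r - l)%N.
Proof. by rewrite size_map size_iota. Qed.

Lemma count_letters o a l r :
  count snd (letters o a l r) = [&& a.1, l == 0%N & (0 < r)%N].
Proof.
rewrite /letters count_map /index_iota.
have slotS i : (0 < i)%N -> slot a i = false by case: i.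
have E m k : (0 < m)%N -> count (preim (fun i => ((o + i)%N, slot a i)) snd) (iota m k) = 0%N.
  by elim: k m => //= k IHk m m0; rewrite slotS // IHk.
case: l r => [|l] [|r] //=; rewrite ?andbF ?subn0 //= ?E //.
by rewrite addn0 andbT.
Qed.

Lemma letters_nil o a l r : (r <= l)%N -> letters o a l r = [::].
Proof. by move=> rl; rewrite /letters /index_iota (eqP rl). Qed.

Lemma letters_head o a : letters o a 0 1 = [:: (o, a.1)].
Proof. by rewrite /letters /= addn0. Qed.

Lemma filter_even (w : seq (nat * bool)) :
  count snd w = 0%N -> [seq x <- w | x.2] = [::].
Proof. by move=> w0; apply/eqP; rewrite -size_eq0 size_filter w0. Qed.

Section Words.
Context (K : fieldType) (n : nat).
Local Notation c w := (cyc K n [seq x.2 | x <- w]).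
Implicit Types (w : seq (nat * bool)).

(** There are two kinds of vertices: n+2 letters epsilon, and a product with the
    unit followed by the pairing, which has three letters, two of them units. *)
Lemma cyc_word w : c w != 0 ->
  ~~ odd (count snd w) && (size w == if count snd w == 0 then n.+2 else 3)%N.
Proof.
have cw : count snd w = count id [seq x.2 | x <- w] by rewrite count_map.
move=> cN0; apply/andP; split.
  by apply: contraNN cN0 => odd_w; rewrite cyc_parity // -cw.
case: ifP => [/eqP w0|/negbT].
  apply: contraNT cN0 => sw; apply/eqP/cyc_eps; rewrite ?size_map //.
  by move/eqP: w0; rewrite cw eqn0Ngt -has_count; apply: contra => tw; apply/hasP; exists true.
rewrite -lt0n cw -has_count => /hasP[b bw b1].
apply: contraNT cN0 => sw; apply/eqP/cyc_unit; rewrite ?size_map //.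
by case: b b1 bw.
Qed.

Lemma cyc_word_eps w : (0 < n)%N -> count snd w = 0%N -> size w = n.+2 ->
  c w = n.+1%:R^-1.
Proof.
move=> n0 w0 sw; rewrite -(cyc_counit K n0) -sw -(size_map snd) //; congr cyc.
apply/all_pred1P/allP => b /mapP[x xw ->].
have /hasPn/(_ x xw)/negbTE -> // : ~~ has snd w by rewrite has_count w0.
Qed.

Lemma sum_delta m k : (k < m)%N -> \sum_(i < m) ((i : nat) == k)%:R = 1 :> K.
Proof.
move=> km; rewrite (bigD1 (Ordinal km)) //= eqxx big1 ?addr0 // => i.
by rewrite -val_eqE /= => /negPf ->.
Qed.

End Words.

(** The vertex of the Mukai pairing or of the coproduct that carries the letter
    a_0: two outer arcs of letters of a meeting at a_0, and two edges enclosing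
    an arc of letters of b. *)
Section Vertex.
Context (o p l r e e' o' l' r' : nat) (a b : chain) (s t : bool).
Let w := letters o a l.+1 r ++ letters o a 0 p.+1
  ++ (e, s) :: letters o' b l'.+1 r' ++ [:: (e', t)].

Lemma count_vertex : count snd w = (a.1 + s + t)%N.
Proof.
rewrite /w -cat1s !count_cat !count_letters.
by rewrite /= !andbF andbT !add0n !addn0 addnA.
Qed.

Lemma size_vertex : size w = (r - l.+1 + p + (r' - l'.+1) + 3)%N.
Proof. by rewrite /w -cat1s !size_cat !size_letters /=; lia. Qed.

End Vertex.

(** * The Mukai pairing *)

Section Mukai.
Context (K : fieldType) (charK : [pchar K] =i pred0) (n : nat) (n_gt0 : (0 < n)%N).

Lemma two_vertices_eq0 (x : K) (w1 w2 : seq (nat * bool)) :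
    (forall e1 e2 : nat, e1 = count snd w1 -> e2 = count snd w2 ->
     ~~ odd e1 -> ~~ odd e2 -> size w1 = (if e1 == 0 then n.+2 else 3)%N ->
     size w2 = (if e2 == 0 then n.+2 else 3)%N -> False) ->
  x * cyc K n [seq y.2 | y <- w1] * cyc K n [seq y.2 | y <- w2] = 0.
Proof.
move=> w12; apply/eqP; rewrite -mulrA mulf_eq0; apply/orP; right.
rewrite -[_ == 0]negbK mulf_eq0 negb_or; apply/negP => /andP[].
move=> /cyc_word/andP[e1 /eqP s1] /cyc_word/andP[e2 /eqP s2].
exact: w12 (erefl _) (erefl _) e1 e2 s1 s2.
Qed.

Lemma mukai_basis_mixed (a b : chain) : a.1 (+) b.1 -> mukai_basis K n a b = 0.
Proof.
move=> ab; rewrite /mukai_basis; do 4!(apply: big1 => ? _).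
apply: big1 => s _; apply: big1 => t _; apply: two_vertices_eq0 => e1 e2.
rewrite !count_vertex => -> -> o1 o2 _ _.
by case: (a.1) (b.1) s t ab o1 o2 => [] [] [] [].
Qed.

(** Both vertices carry a unit, so both have three letters: a_0 or b_0 and the
    two edges. This forces i = j = 0, where the two ways of running the other
    unit through the edges cancel. *)
Lemma mukai_basis_theta i j : mukai_basis K n (true, i) (true, j) = 0.
Proof.
have [ij|ij] := boolP ((i == 0%N) && (j == 0%N)); last first.
  rewrite /mukai_basis; apply: big1 => q _; apply: big1 => p _.
  apply: big1 => q' _; apply: big1 => p' _; apply: big1 => s _; apply: big1 => t _.
  apply: two_vertices_eq0 => e1 e2; rewrite !count_vertex !size_vertex => -> -> _ _.
  rewrite -(addnA 1%N s t) -(addnA 1%N (~~ s)) !add1n /=.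
  by have := ltn_ord q; have := ltn_ord p; have := ltn_ord q'; have := ltn_ord p'; lia.
case/andP: ij => /eqP -> /eqP ->; rewrite /mukai_basis /=.
do 4!rewrite big_ord_recl big_ord0 /=.
rewrite !big_bool /= /dual_coef /ksign /letters /= -![slot _ 0]/true.
rewrite (@cyc_parity K n [:: true; true; true]) // (@cyc_parity K n [:: true; false; false]) //.
rewrite cyc_ttf cyc_tft; ring.
Qed.

(** Either the edges carry two units at the first vertex, which then consists of
    a_0 and the two edges, or they do so at the second one. The other vertex
    takes the remaining letters, so i + j + 3 = n + 2. *)
Lemma mukai_term_eps (i j q p q' p' : nat) (s t : bool) :
    (q <= i)%N -> (p <= q)%N -> (q' <= j)%N -> (p' <= q')%N ->
  let a : chain := (false, i) in let b : chain := (false, j) in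
  let w1 := letters 4 a q.+1 i.+1 ++ letters 4 a 0 p.+1 ++ (0%N, s)
    :: letters (5 + i) b p'.+1 q'.+1 ++ [:: (2%N, t)] in
  let w2 := letters (5 + i) b q'.+1 j.+1 ++ letters (5 + i) b 0 p'.+1
    ++ (1%N, ~~ s) :: letters 4 a p.+1 q.+1 ++ [:: (3%N, ~~ t)] in
  ksign K (w1 ++ w2) * dual_coef K s * dual_coef K t
    * cyc K n [seq x.2 | x <- w1] * cyc K n [seq x.2 | x <- w2] =
  (i + j.+1 == n)%N%:R / n.+1%:R *
    (if s && t then (q == i)%:R * (p == 0%N)%:R * (p' == q')%:R
     else if s || t then 0
     else (p == q)%:R * (p' == 0%N)%:R * (q' == j)%:R).
Proof.
move=> qi pq q'j p'q' a b w1 w2.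
have cw1 : count snd w1 = (s + t)%N by rewrite count_vertex.
have cw2 : count snd w2 = (~~ s + ~~ t)%N by rewrite count_vertex.
have sw1 : size w1 = (i - q + p + (q' - p') + 3)%N by rewrite size_vertex; lia.
have sw2 : size w2 = (j - q' + p' + (q - p) + 3)%N by rewrite size_vertex; lia.
have [/andP[sT tT]|/negbTE st] := boolP (s && t).
  have [[ij qE pE p'E]|ne] : [/\ (i + j.+1)%N = n, q = i, p = 0%N & p' = q'] \/
      ~ [/\ (i + j.+1)%N = n, q = i, p = 0%N & p' = q'] by exact: EM.
    have w2n : count snd w2 = 0%N by rewrite cw2 sT tT.
    rewrite (@cyc_word_eps K n w2) //; last by rewrite sw2; lia.
    rewrite /ksign filter_cat (filter_even w2n) cats0.
    rewrite /w1 qE pE p'E !(letters_nil _ _ (leqnn _)) letters_head ij !eqxx sT tT.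
    by rewrite /= cyc_ftt; ring.
  rewrite two_vertices_eq0 => [|e1 e2 -> -> _ _]; last first.
    by rewrite cw1 cw2 sw1 sw2 sT tT /= => s1 s2; apply: ne; split; lia.
  have [ij|_] := eqVneq (i + j.+1)%N n; last by rewrite !mul0r.
  have [qE|_] := eqVneq q i; last by rewrite !mul0r mulr0.
  have [pE|_] := eqVneq p 0%N; last by rewrite !(mul0r, mulr0).
  by have [p'E|_] := eqVneq p' q'; [case: ne | rewrite !mulr0].
have [st'|] := boolP (s || t).
  rewrite two_vertices_eq0 ?mulr0 // => e1 e2 -> _.
  by rewrite cw1; case: (s) (t) st st' => [] [].
rewrite negb_or => /andP[/negbTE sF /negbTE tF].
have [[ij qE pE p'E]|ne] : [/\ (i + j.+1)%N = n, p = q, p' = 0%N & q' = j] \/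
    ~ [/\ (i + j.+1)%N = n, p = q, p' = 0%N & q' = j] by exact: EM.
  have w1n : count snd w1 = 0%N by rewrite cw1 sF tF.
  rewrite (@cyc_word_eps K n w1) //; last by rewrite sw1; lia.
  rewrite /ksign filter_cat (filter_even w1n) cat0s.
  rewrite /w2 qE pE p'E !(letters_nil _ _ (leqnn _)) letters_head ij !eqxx sF tF.
  by rewrite /= cyc_ftt; ring.
rewrite two_vertices_eq0 => [|e1 e2 -> -> _ _]; last first.
  by rewrite cw1 cw2 sw1 sw2 sF tF /= => s1 s2; apply: ne; split; lia.
have [ij|_] := eqVneq (i + j.+1)%N n; last by rewrite !mul0r.
have [qE|_] := eqVneq p q; last by rewrite !mul0r mulr0.
have [pE|_] := eqVneq p' 0%N; last by rewrite !(mul0r, mulr0).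
by have [p'E|_] := eqVneq q' j; [case: ne | rewrite !mulr0].
Qed.

(** The two kinds of terms are j + 1 and i + 1 in number, one for each position
    of the edges at the all-epsilon vertex. Their total i + j + 2 = n + 1 cancels
    the coefficient 1/(n+1) of that vertex. *)
Lemma mukai_basis_eps (i j : nat) :
  mukai_basis K n (false, i) (false, j) = (i + j.+1 == n)%N%:R.
Proof.
pose x : K := (i + j.+1 == n)%N%:R / n.+1%:R.
pose d q p q' p' : K := (q == i)%:R * (p == 0%N)%:R * (p' == q')%:R
  + (p == q)%:R * (p' == 0%N)%:R * (q' == j)%:R.
transitivity (\sum_(q < i.+1) \sum_(p < q.+1) \sum_(q' < j.+1) \sum_(p' < q'.+1)
  x * d q p q' p').
  apply: eq_bigr => q _; apply: eq_bigr => p _; apply: eq_bigr => q' _.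
  apply: eq_bigr => p' _.
  have E s t := @mukai_term_eps i j q p q' p' s t (ltn_ord q) (ltn_ord p) (ltn_ord q') (ltn_ord p').
  apply: etrans (eq_bigr _ (fun s _ => eq_bigr _ (fun t _ => E s t))) _.
  by rewrite !big_bool /= -/x !mulr0 addr0 add0r -mulrDr.
transitivity (\sum_(q < i.+1) \sum_(p < q.+1) \sum_(q' < j.+1)
    x * ((q == i :> nat)%:R * (p == 0%N :> nat)%:R + (p == q :> nat)%:R * (q' == j :> nat)%:R)).
  apply: eq_bigr => q _; apply: eq_bigr => p _; apply: eq_bigr => q' _.
  rewrite -mulr_sumr big_split /= -!mulr_sumr -!mulr_suml -!mulr_sumr.
  by rewrite !sum_delta // !mulr1.
transitivity (\sum_(q < i.+1) \sum_(p < q.+1)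
    x * ((q == i :> nat)%:R * (p == 0%N :> nat)%:R * j.+1%:R + (p == q :> nat)%:R)).
  apply: eq_bigr => q _; apply: eq_bigr => p _.
  rewrite -mulr_sumr big_split /= -!mulr_sumr sum_delta // mulr1.
  by rewrite sumr_const card_ord -[_ *+ j.+1]mulr_natr mulrA.
transitivity (\sum_(q < i.+1) x * ((q == i :> nat)%:R * j.+1%:R + 1)).
  apply: eq_bigr => q _.
  by rewrite -mulr_sumr big_split /= -mulr_suml -mulr_sumr !sum_delta // mulr1.
rewrite -mulr_sumr big_split /= -mulr_suml sum_delta // mul1r sumr_const card_ord.
rewrite -natrD /x; have [ij|_] := eqVneq (i + j.+1)%N n; last by rewrite !mul0r.
have /pcharf0P nz := charK.
rewrite (_ : (j.+1 + i.+1)%N = n.+1); last by lia.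
by rewrite mul1r mulVf // nz.
Qed.

Lemma mukai_basisE (a b : chain) :
  mukai_basis K n a b = [&& ~~ a.1, ~~ b.1 & (a.2 + b.2.+1 == n)%N]%:R.
Proof.
case: a b => [[] i] [[] j] /=.
- exact: mukai_basis_theta.
- exact: mukai_basis_mixed.
- exact: mukai_basis_mixed.
- exact: mukai_basis_eps.
Qed.

(** The radical of the pairing thus contains all chains 1|epsilon^k, among which b
    and B take their values, and all epsilon|epsilon^k with k >= n. *)
Lemma mukaiE (x y : chains K) :
  mukai n x y = \sum_(k < n) x@_(false, k : nat) * y@_(false, (n - k.+1)%N).
Proof.
pose F (a : chain) : K^o := \sum_(b <- msupp y) y@_b * mukai_basis K n a b.
transitivity (linext F x).
  by apply: eq_bigr => a _; rewrite /F /GRing.scale /= mulr_sumr; apply: eq_bigr => b _; rewrite mulrA.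
have FE (k : 'I_n) : F (false, k : nat) = y@_(false, (n - k.+1)%N).
  rewrite -[LHS]/(linext (fun b => mukai_basis K n (false, k : nat) b : K^o) y).
  rewrite (@linext_pick _ _ _ _ unit (fun=> (false, (n - k.+1)%N) : chain)) => [||b nb].
  - rewrite big_const card_unit /= addr0 mukai_basisE /=.
    by rewrite addnS -addSn subnKC // eqxx /GRing.scale /= mulr1.
  - by case=> [[]].
  rewrite mukai_basisE; case: b nb => [[|] m] //= /(_ tt) nb.
  have [E|//] := eqVneq (k + m.+1)%N n; case/eqP: nb; congr (_, _); lia.
rewrite (@linext_pick _ _ _ _ _ (fun k : 'I_n => (false, k : nat) : chain)) => [||a na].
- by apply: eq_bigr => k _; rewrite FE.
- by move=> k l [] /val_inj.
rewrite /F big1 // => b _; rewrite mukai_basisE; case: a na => [[|] m] na.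
  by rewrite mulr0.
have [mn|mn] := ltnP m n; first by have /eqP := na (Ordinal mn).
case: eqP => [E|_]; last by rewrite !andbF mulr0.
by move: E mn => /= ; lia.
Qed.

End Mukai.

(** * The coproduct and the genus one operations *)

Section Coproduct.
Context (K : fieldType) (n : nat).

(** An output epsilon forces a unit on its edge, and two units leave room for a
    single letter at the vertex: this is a_0. *)
Lemma coproduct_term (a : chain) (l t s r : nat) :
    (l <= a.2)%N -> (t <= l)%N -> (s <= t)%N -> (r <= s)%N ->
  let A := letters 2 a in
  let w := A l.+1 a.2.+1 ++ A 0 r.+1 ++ (0%N, true)
             :: A s.+1 t.+1 ++ [:: ((a.2 + 3)%N, true)] in
  let o1 := (1%N, false) :: A r.+1 s.+1 in
  let o2 := ((a.2 + 4)%N, false) :: A t.+1 l.+1 in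
  ksign K (w ++ o1 ++ o2) * dual_coef K true * dual_coef K true
    * cyc K n [seq x.2 | x <- w] =
  (~~ a.1)%:R * (l == a.2)%:R * (s == t)%:R * (r == 0%N)%:R.
Proof.
move=> la tl st rs A w o1 o2.
have cw : count snd w = (a.1 + true + true)%N by rewrite count_vertex.
have sw : size w = (a.2 - l + r + (t - s) + 3)%N by rewrite size_vertex; lia.
have o12 : count snd (o1 ++ o2) = 0%N.
  by rewrite count_cat /o1 /o2 -cat1s -(cat1s (_, false) (A t.+1 _)) !count_cat
    !count_letters /= !andbF.
have [z|nz] := boolP (cyc K n [seq x.2 | x <- w] != 0); last first.
  rewrite (eqP (negPn nz)) mulr0.
  have [aF|aF] := boolP a.1; first by rewrite !mul0r.
  have [lE|_] := eqVneq l a.2; last by rewrite mulr0 !mul0r.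
  have [sE|_] := eqVneq s t; last by rewrite mulr0 !mul0r.
  have [rE|_] := eqVneq r 0%N; last by rewrite mulr0.
  case/negP: nz; rewrite /w /A lE sE rE !(letters_nil _ _ (leqnn _)) letters_head (negbTE aF) /=.
  by rewrite cyc_ftt oner_eq0.
have /andP[ew /eqP] := cyc_word z; rewrite cw in ew *; case: (boolP a.1) ew => //= aF _.
rewrite sw => sE; have {sE} [lE sE rE] : [/\ l = a.2, s = t & r = 0%N] by split; lia.
rewrite /ksign filter_cat (filter_even o12) cats0.
rewrite /w /A lE sE rE !(letters_nil _ _ (leqnn _)) letters_head (negbTE aF) /=.
by rewrite cyc_ftt !eqxx expr0 !mulr1.
Qed.

Lemma sum_pick (M : lmodType K) m k (G : nat -> M) : (k < m)%N ->
  \sum_(i < m) ((i : nat) == k)%:R *: G i = G k.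
Proof.
move=> km; rewrite (bigD1 (Ordinal km)) //= eqxx scale1r big1 ?addr0 // => i.
by rewrite -val_eqE /= => /negPf ->; rewrite scale0r.
Qed.

Lemma sum_bool2 (M : nmodType) (G : bool -> bool -> M) :
    (forall p, G p false = 0) -> (forall q, G false q = 0) ->
  \sum_p \sum_q G p q = G true true.
Proof. by move=> Gr Gl; rewrite !big_bool /= !Gr !Gl !addr0. Qed.

(** The outputs starting with a unit are discarded by f, as they are radical for
    the Mukai pairing. For a = epsilon|epsilon^k with k < n, what remains is
    the coproduct dual to the product of K[x]/(x^n). *)
Lemma coproduct_eps (M : lmodType K) (f : (chain * chain)%type -> M) (a : chain) :
    (forall b c : chain, b.1 || c.1 -> f (b, c) = 0) ->
  linext f (coproduct n << a >>) =
  (~~ a.1)%:R *: \sum_(t < a.2.+1) f ((false, t : nat), (false, (a.2 - t)%N)).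
Proof.
move=> f0; rewrite /coproduct linextU.
pose F (l t s r : nat) := (~~ a.1)%:R *: ((l == a.2)%:R *: ((s == t)%:R *:
  ((r == 0%N)%:R *: f ((false, (s - r)%N), (false, (l - t)%N))))).
transitivity (\sum_(l < a.2.+1) \sum_(t < l.+1) \sum_(s < t.+1) \sum_(r < s.+1) F l t s r).
  rewrite linear_sum; apply: eq_bigr => l _; rewrite linear_sum; apply: eq_bigr => t _.
  rewrite linear_sum; apply: eq_bigr => s _; rewrite linear_sum; apply: eq_bigr => r _.
  rewrite linear_sum; apply: etrans (eq_bigr _ (fun p _ => linear_sum _ _ _ _)) _.
  apply: etrans (eq_bigr _ (fun p _ => eq_bigr _ (fun q _ => linextZU f _ _))) _.
  apply: etrans (sum_bool2 _ _) _ => [p|q|].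
  - by rewrite f0 ?orbT ?scaler0.
  - by rewrite f0 ?scaler0.
  have /= E := @coproduct_term a l t s r (ltn_ord l) (ltn_ord t) (ltn_ord s) (ltn_ord r).
  apply: etrans (congr1 (fun x => x *: f ((false, (s - r)%N), (false, (l - t)%N))) E) _.
  by rewrite /F !scalerA.
rewrite scaler_sumr.
transitivity (\sum_(l < a.2.+1) (l == a.2 :> nat)%:R *: \sum_(t < l.+1)
    (~~ a.1)%:R *: f ((false, t : nat), (false, (l - t)%N))); last first.
  apply: etrans (@sum_pick _ a.2.+1 a.2 (fun l => \sum_(t < l.+1)
    (~~ a.1)%:R *: f ((false, t : nat), (false, (l - t)%N))) _) _ => //.
apply: eq_bigr => l _; rewrite scaler_sumr; apply: eq_bigr => t _.
rewrite /F; under eq_bigr => s _.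
  rewrite -!scaler_sumr (@sum_pick _ s.+1 0 (fun r => f ((false, (s - r)%N), (false, (l - t)%N)))) //.
  rewrite subn0; over.
rewrite -!scaler_sumr (@sum_pick _ t.+1 t (fun s => f ((false, s), (false, (l - t)%N)))) //.
by rewrite !scalerA mulrC.
Qed.

End Coproduct.

Section Ribbon.
Context (K : fieldType) (n : nat).

Lemma count_word (half : nat -> nat * bool) (placed : nat -> seq (nat * bool)) v :
    (forall h, count snd (placed h) = 0%N) ->
  count snd (flatten [seq half h :: placed h | h <- v]) =
  count (fun h => (half h).2) v.
Proof.
move=> p0; elim: v => //= h v IHv.
by rewrite -IHv count_cat p0.
Qed.

Lemma prod_vertices_parity (word : seq nat -> seq (nat * bool)) (odd_half : pred nat)
    (G : seq (seq nat)) :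
    (forall v, count snd (word v) = count odd_half v) ->
    odd (\sum_(v <- G) count odd_half v) ->
  \prod_(v <- G) cyc K n [seq x.2 | x <- word v] = 0.
Proof.
move=> wordE; elim: G => [|v G IHG]; rewrite ?big_nil // !big_cons oddD.
have [odd_v _|_ /= oG] := boolP (odd (count odd_half v)); last by rewrite IHG ?mulr0.
by rewrite cyc_parity ?mul0r // count_map (wordE v : count _ _ = _).
Qed.

(** Each edge carries exactly one odd letter, whichever basis vector runs through
    it, and the vertices are even: an odd input thus needs an odd number of
    edges. *)
Lemma ribbon_basis_theta k :
  ribbon_basis K n G2 4 (true, k) = 0 /\ ribbon_basis K n G3 2 (true, k) = 0.
Proof.
pose half m (s : m.-tuple bool) h : nat * bool := if h == 0%N then (m.*2.+1, true)
  else (h, if odd h then nth false s h./2 else ~~ nth false s h.-1./2).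
have placed0 m (G : seq (seq nat)) (f : k.-tuple 'I_m.*2.+1) h :
    count snd [seq ((m.*2.+1 + i)%N, slot (true, k) i) | i <- iota 1 k
      & nth 0%N (corners G m) (nth ord0 f i.-1) == h] = 0%N.
  rewrite count_map; apply/eqP; rewrite -leqn0 leqNgt -has_count.
  by apply/hasPn => i; rewrite mem_filter mem_iota /slot => /andP[_ /andP[]]; case: i.
split; apply: big1 => s _; apply: big1 => f _.
  apply: etrans (congr1 ( *%R _) (@prod_vertices_parity _
    (fun h => (half _ s h).2) _ _ _)) (mulr0 _); first by move=> v; apply: count_word.
  rewrite /G2 !big_cons big_nil /half /=.
  by case: (nth false s 0) (nth false s 1) (nth false s 2) (nth false s 3) => [] [] [] [].
apply: etrans (congr1 ( *%R _) (@prod_vertices_parity _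
  (fun h => (half _ s h).2) _ _ _)) (mulr0 _); first by move=> v; apply: count_word.
rewrite /G3 !big_cons big_nil /half /=.
by case: (nth false s 0) (nth false s 1) => [] [].
Qed.

End Ribbon.

(** * The propagator *)

Section Propagator.
Context (K : fieldType) (charK : [pchar K] =i pred0) (n : nat) (n_gt0 : (0 < n)%N).
Implicit Types (x y z : laurent K).

Lemma laurent_lin (a : K) x y i : (a *: x + y) i = a *: x i + y i.
Proof. by []. Qed.

Lemma mukai_linearl (a : K) (x y z : chains K) :
  mukai n (a *: x + y) z = a * mukai n x z + mukai n y z.
Proof.
rewrite !(mukaiE charK) // mulr_sumr -big_split; apply: eq_bigr => k _ /=.
by rewrite mcoeffD mcoeffZ; ring.
Qed.

Lemma mukaiC (x y : chains K) : mukai n x y = mukai n y x.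
Proof.
rewrite !(mukaiE charK) // (reindex_inj rev_ord_inj); apply: eq_bigr => k _ /=.
by rewrite mulrC subnSK // subKn // ltnW.
Qed.

Lemma mukai_linearr (a : K) (x y z : chains K) :
  mukai n z (a *: x + y) = a * mukai n z x + mukai n z y.
Proof. by rewrite mukaiC mukai_linearl !(mukaiC _ z). Qed.

Lemma mukai0l (x : chains K) : mukai n 0 x = 0.
Proof. by rewrite /mukai msupp0 big_nil. Qed.

Lemma mukai0r (x : chains K) : mukai n x 0 = 0.
Proof. by rewrite mukaiC mukai0l. Qed.

Definition residue_term x y (i : int) : K := (-1) ^ i * mukai n (x i) (y (- 1 - i)).

Definition finite_supp (f : int -> K) : Prop :=
  exists A : {fset int}, forall i, i \notin A -> f i = 0.

Lemma residue_finite x y : finite_supp (residue_term x y).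
Proof.
have /asboolP[N xN] := laurentP x; have /asboolP[M yM] := laurentP y.
exists (seq_fset tt [seq N + k%:Z | k <- iota 0 `|(- M - N)%R|.+1]) => i.
rewrite seq_fsetE => iA; rewrite /residue_term.
have [iN|Ni] := ltP i N; first by rewrite xN // mukai0l mulr0.
have [iM|Mi] := ltP (- 1 - i) M; first by rewrite yM // mukai0r mulr0.
case/negP: iA; apply/mapP; exists `|(i - N)%R|%N; last by lia.
by rewrite mem_iota; lia.
Qed.

Lemma fsum_linear (a : K) (f g : int -> K) : finite_supp f -> finite_supp g ->
  \sum_(i \in [set: int]) (a * f i + g i) =
  a * (\sum_(i \in [set: int]) f i) + \sum_(i \in [set: int]) g i.
Proof.
move=> [A fA] [B gB]; pose C := fsetU A B.
have out i : i \notin C -> (i \notin A) && (i \notin B).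
  by rewrite in_fsetU negb_or.
rewrite !(fsbigTE C) => [|i /out/andP[iA iB]|i /out/andP[iA iB]|i /out/andP[iA iB]];
  rewrite ?fA ?gB ?mulr0 ?addr0 //.
by rewrite mulr_sumr -big_split.
Qed.

Definition propagator_term x y (i : int) : K :=
  if 0 <= i then residue_term x y i else 0.

(** The expectation value of x y in the vacuum that is killed by L[[u]] on the
    right and by negative powers of u on the left: only the part of x in degrees
    at least zero meets y. *)
Definition propagator x y : K :=
  \sum_(i \in [set: int]) propagator_term x y i.

Lemma propagator_finite x y : finite_supp (propagator_term x y).
Proof.
have [A xyA] := residue_finite x y; exists A => i iA.
by rewrite /propagator_term xyA // if_same.
Qed.

Lemma propagator_linearl (a : K) x y z :
  propagator (a *: x + y) z = a * propagator x z + propagator y z.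
Proof.
rewrite /propagator -fsum_linear; try exact: propagator_finite.
apply: eq_fsbigr => i _; rewrite /propagator_term; case: ifP => _; last first.
  by rewrite mulr0 addr0.
by rewrite /residue_term laurent_lin mukai_linearl; ring.
Qed.

Lemma propagator_linearr (a : K) x y z :
  propagator z (a *: x + y) = a * propagator z x + propagator z y.
Proof.
rewrite /propagator -fsum_linear; try exact: propagator_finite.
apply: eq_fsbigr => i _; rewrite /propagator_term; case: ifP => _; last first.
  by rewrite mulr0 addr0.
by rewrite /residue_term laurent_lin mukai_linearr; ring.
Qed.

(** Reflecting degrees by i |-> -1-i exchanges the arguments of the residue
    pairing and changes its sign, so the second term supplies the degrees i < 0
    absent from the first. *)
Lemma propagator_commutator x y :
  propagator x y - propagator y x = residue_pairing n x y.
Proof.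
pose h (i : int) : int := - 1 - i.
have hK : cancel h h by move=> i; rewrite /h; lia.
have -> : propagator y x = - \sum_(i \in [set: int]) (if i < 0 then residue_term x y i else 0).
  rewrite /propagator (reindex_fsbigT h); last by exists h.
  have := @fsum_linear (-1) (fun i : int => if i < 0 then residue_term x y i else 0) (fun=> 0).
  rewrite mulN1r [X in _ + X]fsbig1 // addr0 => <-; last 2 first.
  - by have [A xyA] := residue_finite x y; exists A => i iA; rewrite xyA // if_same.
  - by exists fset0.
  apply: eq_fsbigr => i _; rewrite /propagator_term /h addr0.
  rewrite (_ : (0 <= - 1 - i) = (i < 0)); last by lia.
  case: ifP => _; last by rewrite mulr0.
  rewrite /residue_term mukaiC mulN1r (_ : - 1 - (- 1 - i) = i); last by lia.
  rewrite -mulNr; congr (_ * _).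
  by rewrite expfzDr ?oppr_eq0 ?oner_eq0 // exprN1 -exprz_inv invrN1 mulN1r.
rewrite opprK addrC -[X in X + _]mul1r -fsum_linear ?mul1r.
- apply: eq_fsbigr => i _; rewrite /propagator_term mul1r.
  by case: ltP => _; rewrite ?add0r ?addr0.
- by have [A xyA] := residue_finite x y; exists A => i iA; rewrite xyA // if_same.
- exact: propagator_finite.
Qed.

Lemma propagator_eq0 x y :
    (forall i k, 0 <= i -> (k < n)%N -> (x i)@_(false, k) = 0) \/
    (forall i k, i < 0 -> (k < n)%N -> (y i)@_(false, k) = 0) ->
  propagator x y = 0.
Proof.
move=> xy; apply: fsbig1 => i _; rewrite /propagator_term; case: ifP => // i0.
rewrite /residue_term (mukaiE charK) // big1 ?mulr0 // => k _.
have nk : (n - k.+1 < n)%N by rewrite ltn_subrL n_gt0.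
case: xy => [x0|y0]; first by rewrite x0 ?mul0r.
by rewrite y0 ?mulr0 //; lia.
Qed.

Lemma mukai_eps x (i : int) (s : 'I_n) :
  mukai n (x i) << (false, s : nat) : chain >> = (x i)@_(false, (n - s.+1)%N).
Proof.
rewrite (mukaiE charK) // (bigD1 (rev_ord s)) //= subnSK // subKn ?(ltnW (ltn_ord s)) //.
rewrite mcoeffUU mulr1 big1 ?addr0 // => k ks.
rewrite mcoeffU; case: eqP => [[sE]|]; last by rewrite mulr0.
by case/eqP: ks; apply: val_inj => /=; have := ltn_ord k; lia.
Qed.

Lemma propagator_pole x (m : nat) (c : chains K) :
  propagator x (laurent_shift (- m.+1%:Z) (laurent_const c)) =
  (-1) ^+ m * mukai n (x m) c.
Proof.
pose y := laurent_shift (- m.+1%:Z) (laurent_const c).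
have yE (i : int) : y (- 1 - i) = if i == m then c else 0.
  rewrite /y /= /laurent_series /=.
  have -> : - 1 - i - - m.+1%:Z = m%:Z - i by lia.
  have [->|im] := eqVneq i m; first by rewrite subrr.
  by case E: (m%:Z - i) => [[|l]|l] //; lia.
rewrite /propagator (fsbigTE [fset (m : int)]%fset) => [|i].
  by rewrite big_seq_fset1 /propagator_term /= /residue_term yE eqxx -exprnP.
rewrite inE => /negbTE im; rewrite /propagator_term /residue_term yE im.
by rewrite mukaiC mukai0l mulr0 if_same.
Qed.

End Propagator.

(** * Closed series *)

Section Coefficients.
Context (K : fieldType) (n : nat).

Lemma mcoeff_linext (X Y : choiceType) (f : X -> {malg K[Y]}) (x : {malg K[X]}) b :
  (linext f x)@_b = linext (fun a => (f a)@_b : K^o) x.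
Proof.
rewrite /linext raddf_sum; apply: eq_bigr => a _ /=; exact: mcoeffZ.
Qed.

Lemma linext0f (X : choiceType) (f : X -> K^o) (x : {malg K[X]}) :
  (forall a, f a = 0) -> linext f x = 0 :> K.
Proof. by move=> f0; apply: big1 => a _; rewrite f0 scaler0. Qed.

Lemma linext_pick1 (X : choiceType) (f : X -> K^o) (x : {malg K[X]}) (b : X) :
  (forall a, a != b -> f a = 0) -> linext f x = x@_b * f b.
Proof. exact: linext_single. Qed.

Lemma hoch_b_eps (x : chains K) k : (hoch_b n x)@_(false, k) = 0.
Proof.
rewrite /hoch_b mcoeff_linext; apply: linext0f => a.
by case: ifP => _; rewrite ?mcoeff0 // mcoeffU.
Qed.

Lemma connes_B_eps (x : chains K) k : (connes_B x)@_(false, k) = 0.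
Proof.
rewrite /connes_B mcoeff_linext; apply: linext0f => a.
by case: ifP => _; rewrite ?mcoeff0 // mcoeffZ mcoeffU /= mulr0.
Qed.

Lemma hoch_b_theta (x : chains K) k : (hoch_b n x)@_(true, k) = x@_(false, (k + n)%N).
Proof.
rewrite /hoch_b mcoeff_linext (@linext_pick1 _ _ _ (false, (k + n)%N)) => [|a na].
  by rewrite /= ltnNge leq_addl /= addnK mcoeffU eqxx mulr1.
case: ifP => [_|/negbT]; first by rewrite mcoeff0.
rewrite negb_or -leqNgt => /andP[a1 na2]; rewrite mcoeffU.
case: eqP => // -[E]; case/eqP: na; case: a a1 na2 E => [[] m] //= _ nm <-.
by rewrite subnK.
Qed.

Lemma connes_B_theta (x : chains K) k :
  (connes_B x)@_(true, k) = if k is l.+1 then k%:R * x@_(false, l) else 0.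
Proof.
rewrite /connes_B mcoeff_linext; case: k => [|l].
  apply: linext0f => a; case: ifP => _; rewrite ?mcoeff0 // mcoeffZ mcoeffU.
  by rewrite (_ : _ == _ = false) ?mulr0.
rewrite (@linext_pick1 _ _ _ (false, l)) => [|a na].
  by rewrite /= mcoeffZ mcoeffU eqxx mulr1 mulrC.
case: ifP => [_|/negbT a1]; rewrite ?mcoeff0 // mcoeffZ mcoeffU.
case: eqP => [[E]|]; last by rewrite mulr0.
by case/eqP: na; case: a a1 E => [[] m] //= _ ->.
Qed.

(** In degree zero the equation is b x_0 = 0, and b is injective on the chains
    epsilon|epsilon^k with k >= n. *)
Lemma closed_coef0 (x : laurent K) : nonneg x -> laurent_diff n x = 0 ->
  forall k, (n <= k)%N -> (x 0)@_(false, k) = 0.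
Proof.
move=> x0 dx k nk; have /(congr1 (fun z : laurent K => (z 0)@_(true, (k - n)%N))) := dx.
rewrite /= (x0 (0 - 1)) // /connes_B linext0 addr0 hoch_b_theta subnK //.
by move=> ->; exact: mcoeff0.
Qed.

(** In degree one the equation b x_1 = - B x_0 determines x_1 from x_0 up to
    homology classes and chains starting with a unit. *)
Lemma closed_coef1 (x : laurent K) : laurent_diff n x = 0 ->
  forall k, (x 1)@_(false, (k + n)%N) = - (if k is l.+1 then k%:R * (x 0)@_(false, l) else 0).
Proof.
move=> dx k; have E : (laurent_diff n x 1)@_(true, k) = 0 by rewrite dx; exact: mcoeff0.
apply/eqP; rewrite -addr_eq0; apply/eqP.
by rewrite -[RHS]E /= subrr mcoeffD hoch_b_theta connes_B_theta.
Qed.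

End Coefficients.

(** * Functionals on noncommutative algebras *)

(** Rearrangements of words. In the free algebra they are applied as equations
    between whole products, because matching a factor there unfolds the
    convolution product. *)
Section RingIdentities.
Context (A : pzRingType).
Implicit Types (u v w r s t : A).

Lemma sandwich0 v r : v * 0 * r = 0.
Proof. by rewrite mulr0 mul0r. Qed.

Lemma sandwichD v w u r : v * (w + u) * r = v * w * r + v * u * r.
Proof. by rewrite mulrDr mulrDl. Qed.

Lemma sandwichA v s w t r : v * (s * w * t) * r = v * s * w * (t * r).
Proof. by rewrite !mulrA. Qed.

Lemma sandwich1 w r : w * r = 1 * w * r.
Proof. by rewrite mul1r. Qed.

Lemma prod_expr_head (I : Type) (i : I) (s : seq I) (a : I -> A) (e : I -> nat) w :
  (0 < e i)%N -> exists v, (\prod_(j <- i :: s) a j ^+ e j) * w = a i * v.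
Proof.
move=> ei; exists (a i ^+ (e i).-1 * \prod_(j <- s) a j ^+ e j * w).
by rewrite big_cons !mulrA -exprS prednK.
Qed.

Lemma sandwichM v u w r : v * (u * w) * r = v * u * (w * r).
Proof. by rewrite !mulrA. Qed.

End RingIdentities.

Section Functional.
Context (R : comNzRingType) (A : lalgType R) (f : A -> R)
  (f_lin : forall a v w, f (a *: v + w) = a * f v + f w)
  (mulr_scaler : forall (a : R) (v w : A), v * (a *: w) = a *: (v * w)).

Lemma functional0 : f 0 = 0.
Proof. by apply: (addrI (f 0)); rewrite addr0 -[X in X + _]mul1r -f_lin scaler0 addr0. Qed.

Lemma functionalD v w : f (v + w) = f v + f w.
Proof. by rewrite -[v in LHS]scale1r f_lin mul1r. Qed.

Lemma functionalZ a v : f (a *: v) = a * f v.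
Proof. by rewrite -[a *: v]addr0 f_lin functional0 addr0. Qed.

Lemma functionalB v w : f (v - w) = f v - f w.
Proof. by rewrite functionalD -scaleN1r functionalZ mulN1r. Qed.

Lemma functional_sum I (r : seq I) (P : pred I) (c : I -> R) (u : I -> A) v :
  f (v * \sum_(i <- r | P i) c i *: u i) = \sum_(i <- r | P i) c i * f (v * u i).
Proof.
rewrite mulr_sumr (big_morph f functionalD functional0); apply: eq_bigr => i _.
by rewrite mulr_scaler functionalZ.
Qed.

Lemma functionalDr v p q : f (v * (p + q)) = f (v * p) + f (v * q).
Proof. by rewrite mulrDr functionalD. Qed.

Lemma functionalZr v a p : f (v * (a *: p)) = a * f (v * p).
Proof. by rewrite mulr_scaler functionalZ. Qed.

(** The next three lemmas have the shapes of the linearity relation, of the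
    commutation relation and of the Leibniz rule inside a word. *)
Lemma functional_affine v p c q s r :
  f (v * (p - (c *: q + s)) * r) =
  f (v * p * r) - (c * f (v * q * r) + f (v * s * r)).
Proof.
by rewrite mulrBr mulrDr mulrBl mulrDl mulr_scaler -scalerAl functionalB f_lin.
Qed.

Lemma functional_bracket v p e q c r :
  f (v * (p - e *: q - c *: 1) * r) =
  f (v * p * r) - e * f (v * q * r) - c * f (v * r).
Proof.
rewrite !mulrBr !mulrBl !mulr_scaler -!scalerAl !functionalB !functionalZ.
by rewrite mulr1.
Qed.

Lemma functional_leibniz v p q u w r :
  f (v * (p * q + u * w) * r) = f (v * p * (q * r)) + f (v * u * w * r).
Proof. by rewrite mulrDr mulrDl functionalD !mulrA. Qed.

(** A letter that kills the vacuum to its right is moved through the rest of the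
    word, which it contracts. *)
Section Annihilation.
Context (T : Type) (g : T -> A) (W : T -> T -> R)
  (exchange : forall v r x y,
    f (v * (g x * g y) * r) = f (v * (g y * g x) * r) + W x y * f (v * r))
  (x : T) (x_last : forall v, f (v * g x) = 0).

Lemma annihilate1 v a : f (v * g x * g a) = W x a * f v.
Proof.
have := exchange v 1 x a; rewrite !mulr1 mulrA => ->.
by rewrite mulrA x_last add0r.
Qed.

Lemma annihilate2 v a b :
  f (v * g x * (g a * g b)) = W x a * f (v * g b) + W x b * f (v * g a).
Proof.
have := exchange v (g b) x a; rewrite !mulrA => ->.
by rewrite annihilate1 addrC.
Qed.

Lemma annihilate3 v a b c :
  f (v * g x * (g a * g b * g c)) = W x a * f (v * (g b * g c))
    + W x b * f (v * (g a * g c)) + W x c * f (v * (g a * g b)).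
Proof.
have := exchange v (g b * g c) x a; rewrite !mulrA => ->.
have := annihilate2 (v * g a) b c; rewrite !mulrA => ->; ring.
Qed.

(** By the symmetry of d the three contractions of a cubic contribute equally. *)
Lemma annihilate_cubic (I : finType) (e : R) (d : I -> I -> I -> R) (Y : I -> T) v :
    (forall s t r, d s t r = d t s r) -> (forall s t r, d s t r = d t r s) ->
  f (v * g x * (e *: \sum_s \sum_t \sum_r d s t r *: (g (Y s) * g (Y t) * g (Y r)))) =
  3%:R * e * \sum_s W x (Y s) * \sum_t \sum_r d s t r * f (v * (g (Y t) * g (Y r))).
Proof.
move=> dC dA; rewrite mulr_scaler functionalZ.
pose E t r := f (v * (g (Y t) * g (Y r))).
pose a s := W x (Y s).
rewrite pair_bigA /=; under eq_bigr => p _ do rewrite -[\sum_r _]scale1r.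
rewrite functional_sum -(pair_bigA _ (fun s t => 1 * f (v * g x * \sum_r d s t r *:
   (g (Y s) * g (Y t) * g (Y r))))) /=.
transitivity (e * \sum_s \sum_t \sum_r
    (d s t r * (a s * E t r) + d s t r * (a t * E s r) + d s t r * (a r * E s t))).
  congr (_ * _); apply: eq_bigr => s _; apply: eq_bigr => t _.
  rewrite mul1r functional_sum; apply: eq_bigr => r _.
  by rewrite annihilate3 /a /E; ring.
pose B := \sum_s \sum_t \sum_r d s t r * (a s * E t r).
have B2 : \sum_s \sum_t \sum_r d s t r * (a t * E s r) = B.
  by rewrite exchange_big; do 3!(apply: eq_bigr => ? _); rewrite dC.
have B3 : \sum_s \sum_t \sum_r d s t r * (a r * E s t) = B.
  rewrite /B [RHS]exchange_big /=; apply: eq_bigr => s _.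
  by rewrite [RHS]exchange_big; do 2!(apply: eq_bigr => ? _); rewrite -dA.
transitivity (e * (B + B + B)).
  congr (_ * _); rewrite -{2}B2 -{2}B3 /B -!big_split; apply: eq_bigr => s _.
  rewrite -!big_split; apply: eq_bigr => t _.
  by rewrite -!big_split.
rewrite -/B (_ : \sum_s _ = B); first by ring.
rewrite /B; apply: eq_bigr => s _; rewrite mulr_sumr; apply: eq_bigr => t _.
by rewrite mulr_sumr; apply: eq_bigr => r _; rewrite /E /a; ring.
Qed.

Lemma annihilate_linear (I : finType) (c : I -> R) (Y : I -> T) v :
  f (v * g x * \sum_k c k *: g (Y k)) = (\sum_k c k * W x (Y k)) * f v.
Proof.
rewrite functional_sum mulr_suml; apply: eq_bigr => k _.
by rewrite annihilate1 mulrA.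
Qed.

End Annihilation.

End Functional.

Section Deformed.
Context (K : fieldType) (A : lalgType {poly K}) (f : A -> {poly K}) (S : A)
  (f_lin : forall a v w, f (a *: v + w) = a * f v + f w)
  (mulr_scaler : forall (a : {poly K}) (v w : A), v * (a *: w) = a *: (v * w)).

(** The coefficient of lambda in the expectation value of w between the vacuum
    and the deformed vacuum exp(lambda S)|0>. *)
Definition deformed (w : A) : K := (f (w * (1 + 'X *: S)))`_1.

Lemma deformedE w : deformed w = (f w)`_1 + (f (w * S))`_0.
Proof.
rewrite /deformed mulrDr mulr1 mulr_scaler addrC f_lin addrC coefD.
by rewrite coefXM.
Qed.

Lemma deformed_linear a v w : deformed (a%:P *: v + w) = a * deformed v + deformed w.
Proof.
by rewrite !deformedE f_lin mulrDl -scalerAl f_lin !coefD !coefCM; ring.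
Qed.

Lemma deformedD v w : deformed (v + w) = deformed v + deformed w.
Proof. by have := deformed_linear 1 v w; rewrite polyC1 scale1r mul1r. Qed.

Lemma deformed_lambda v : deformed ('X *: v) = (f v)`_0.
Proof.
rewrite deformedE -scalerAl (functionalZ f_lin) (functionalZ f_lin _ (v * S)).
by rewrite !coefXM addr0.
Qed.

Lemma deformed_relation w x T :
  f (w * x) = 0 -> f (w * x * S) = f (w * T) -> deformed (w * (x - 'X *: T)) = 0.
Proof.
move=> fx fxS; rewrite mulrBr mulr_scaler addrC -scaleN1r -polyCN.
rewrite deformed_linear deformed_lambda deformedE fx fxS coef0 add0r mulN1r.
exact: addNr.
Qed.

End Deformed.

(** * The vacuum of the Weyl algebra *)

Section WeylVacuum.
Context (K : fieldType) (charK : [pchar K] =i pred0) (n : nat) (n_gt0 : (0 < n)%N).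
Implicit Types (x y : laurent K) (v w r : free_algebra K).

Definition vacuum : free_algebra K -> {poly K} :=
  @vac (laurent K) {poly K} (fun x y => (propagator n x y)%:P).

Lemma vacuum_linear a v w : vacuum (a *: v + w) = a * vacuum v + vacuum w.
Proof. exact: vac_scalar. Qed.

Lemma free_scaler (a : {poly K}) v w : v * (a *: w) = a *: (v * w).
Proof. exact: malg_scalerAr. Qed.

Lemma vacuum_exchange v r x y :
  vacuum (v * (gen x * gen y) * r) =
  vacuum (v * (gen y * gen x) * r) + (residue_pairing n x y)%:P * vacuum (v * r).
Proof.
rewrite -(propagator_commutator charK n_gt0) polyCB.
exact: vac_exchange.
Qed.

Lemma vacuum_gen_linear (a : K) x y v r :
  vacuum (v * gen (a *: x + y) * r) =
  a%:P * vacuum (v * gen x * r) + vacuum (v * gen y * r).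
Proof.
apply: vac_linear => t; rewrite -polyCM -polyCD.
  by rewrite (propagator_linearr charK n_gt0).
by rewrite (propagator_linearl charK n_gt0).
Qed.

(** The letters with coefficients in the radical of the Mukai pairing; they behave
    as zero in every expectation value. *)
Definition inert x : Prop := forall i k, (k < n)%N -> (x i)@_(false, k) = 0.

Lemma vacuum_inert x v r : inert x -> vacuum (v * gen x * r) = 0.
Proof.
move=> x0; apply: vac_null => t; rewrite (propagator_eq0 charK n_gt0) //.
  by right=> i k _; apply: x0.
by left=> i k _; apply: x0.
Qed.

Lemma vacuum_last x v : nonneg x -> vacuum (v * gen x) = 0.
Proof.
move=> x0; apply: vac_last => t; rewrite (propagator_eq0 charK n_gt0) //.
by right=> i k i0 _; rewrite x0 // mcoeff0.
Qed.

Lemma vacuum_head x v :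
  (forall i k, 0 <= i -> (k < n)%N -> (x i)@_(false, k) = 0) ->
  vacuum (gen x * v) = 0.
Proof.
by move=> x0; apply: vac_head => t; rewrite (propagator_eq0 charK n_gt0) //; left.
Qed.

Lemma vacuum_one : vacuum 1 = 1.
Proof. exact: vac1. Qed.

Lemma inert_odd x : homogeneous true x -> inert x.
Proof.
move=> hx i k _; apply/eqP; apply: contraT => /hx; by [].
Qed.

Lemma inert_diff x : inert (laurent_diff n x).
Proof. by move=> i k _; rewrite /= mcoeffD hoch_b_eps connes_B_eps addr0. Qed.

Lemma residue_inertl x y : inert x -> residue_pairing n x y = 0.
Proof.
move=> x0; rewrite -(propagator_commutator charK n_gt0).
by rewrite !(propagator_eq0 charK n_gt0) ?subr0 //; [right | left]; move=> i k _; apply: x0.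
Qed.

(** Odd letters are inert, so that only the commutators with an even letter have
    content. *)
Lemma vacuum_weyl_zero w : weyl_zero n w -> forall v r, vacuum (v * w * r) = 0.
Proof.
have vD := functionalD vacuum_linear.
elim=> [|{}w w' _ IHw _ IHw'|s {}w t _ IHw|a x y|p q x y hx hy] v r.
- exact: etrans (congr1 vacuum (sandwich0 v r)) (functional0 vacuum_linear).
- apply: etrans (congr1 vacuum (sandwichD v w w' r)) (etrans (vD _ _) _).
  exact: etrans (congr2 +%R (IHw v r) (IHw' v r)) (addr0 0).
- exact: etrans (congr1 vacuum (sandwichA v s w t r)) (IHw (v * s) (t * r)).
- apply: etrans (functional_affine vacuum_linear free_scaler _ _ _ _ _ _) _.
  by apply/eqP; rewrite subr_eq0; apply/eqP; exact: vacuum_gen_linear.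
- apply: etrans (functional_bracket vacuum_linear free_scaler _ _ _ _ _ _) _.
  case: p q hx hy => [] [] hx hy.
  + have z0 u u' : homogeneous true u -> vacuum (v * (gen u * gen u') * r) = 0.
      by move=> hu; apply: etrans (congr1 vacuum (sandwichM v _ _ r)) (vacuum_inert _ _ (inert_odd hu)).
    have := congr2 (fun a b => a - (-1) ^+ (true && true) * b) (z0 x y hx) (z0 y x hy).
    move=> /= ->; rewrite (residue_inertl _ (inert_odd hx)).
    by move: (vacuum (v * r)) => z; rewrite mulr0 mul0r !subr0.
  all: have br (z z' c : {poly K}) : z' + c * z - 1 * z' - c * z = 0 by ring.
  all: exact: etrans (congr1 (fun a => a - _ - _) (vacuum_exchange v r x y)) (br _ _ _).
Qed.

(** Every term of a boundary contains a letter (b+uB)x, which is inert. *)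
Lemma vacuum_boundary w v r : vacuum (v * weyl_diff n w * r) = 0.
Proof.
have vac0 u : vacuum (u * 0 * r) = 0.
  exact: etrans (congr1 vacuum (sandwich0 u r)) (functional0 vacuum_linear).
have word0 s u : vacuum (u * word_diff n s * r) = 0.
  elim: s u => [|x s IHs] u /=; first exact: vac0.
  apply: etrans (functional_leibniz vacuum_linear _ _ _ _ _ _) _.
  apply: etrans (congr2 +%R (vacuum_inert _ _ (inert_diff x)) (IHs _)) (addr0 0).
have E : weyl_diff n w = \sum_(m <- msupp w) w@_m *: word_diff n m by [].
rewrite E; elim/big_rec: _ => [|m u _ IHu]; first exact: vac0.
apply: etrans (congr1 vacuum (sandwichD v _ u r)) _.
apply: etrans (functionalD vacuum_linear _ _) _.
apply: etrans (congr2 +%R _ IHu) (addr0 0).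
apply: etrans (congr1 vacuum (congr1 (fun z => z * r) (free_scaler _ _ _))) _.
apply: etrans (congr1 vacuum (malg_scalerAl _ _ _)) _.
apply: etrans (functionalZ vacuum_linear _ _) _.
exact: etrans (congr1 ( *%R _) (word0 m v)) (mulr0 _).
Qed.

End WeylVacuum.

(** * The deformed vacuum *)

Section Potential.
Context (K : fieldType) (charK : [pchar K] =i pred0) (n : nat) (n_gt0 : (0 < n)%N).
Implicit Types (x : laurent K) (w : free_algebra K).

(** The chain a times u^(-m-1). *)
Definition pole (m : nat) (a : chain) : laurent K :=
  laurent_shift (- m.+1%:Z) (laurent_const << a >>).

Definition eps_pole (m : nat) (k : 'I_n) : laurent K := pole m (false, k : nat).

Lemma residue_pole x m (k : 'I_n) : nonneg x ->
  residue_pairing n x (eps_pole m k) = (-1) ^+ m * (x m)@_(false, (n - k.+1)%N).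
Proof.
move=> x0; rewrite -(propagator_commutator charK n_gt0) [X in _ - X](propagator_eq0 charK n_gt0).
  by rewrite subr0 (propagator_pole charK n_gt0) (mukai_eps charK n_gt0).
by right=> i l i0 _; rewrite x0 // mcoeff0.
Qed.

Lemma inert_pole m (k : nat) : inert n (pole m (true, k)).
Proof.
move=> i l _; rewrite /pole /= /laurent_series /=.
by case: (_ - _) => [[|j]|j]; rewrite ?mcoeff0 // mcoeffU.
Qed.

(** The value of T_2 + T_3 on the closed lift of epsilon|epsilon^k, whose term of
    degree one is -(k+1) epsilon|epsilon^(k+1+n) u. *)
Definition genus_one_coef (k : nat) : K :=
  fock_T3 n << (false, k) : chain >>
    - k.+1%:R * fock_T2 n << (false, (k.+1 + n)%N) : chain >>.

(** The genus one part of the relation is a linear function of the homology class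
    of x: inputs starting with a unit do not contribute by parity, and the part
    of x_1 outside the span of the classes is determined by x_0. *)
Lemma fock_scalarE x : nonneg x -> laurent_diff n x = 0 ->
  fock_T2 n (x 1) + fock_T3 n (x 0) =
  \sum_(k < n) (x 0)@_(false, k : nat) * genus_one_coef k
    + \sum_(k < n) (x 1)@_(false, k : nat) * fock_T2 n << (false, k : nat) : chain >>.
Proof.
move=> x0 dx.
have inj : injective (fun k : 'I_n => (false, k : nat) : chain) by move=> k l [] /val_inj.
have outE (a : chain) : (forall k : 'I_n, a != (false, k : nat)) -> a.1 || (n <= a.2)%N.
  case: a => [[|] m] //= na; rewrite leqNgt; apply/negP => mn.
  by have /eqP := na (Ordinal mn).
pose R2 (a : chain) : K^o := ribbon_basis K n G2 4 a.
pose R3 (a : chain) : K^o := ribbon_basis K n G3 2 a.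
have T2E (z : chains K) : fock_T2 n z = 24%:R^-1 * linext R2 z by [].
have T3E (z : chains K) : fock_T3 n z = - 4%:R^-1 * linext R3 z by [].
have L3 : linext R3 (x 0) = \sum_(k < n) (x 0)@_(false, k : nat) * R3 (false, k : nat).
  apply: linext_supp => // a /outE; case: a => [[|] m] /= mn.
    by rewrite /R3 (ribbon_basis_theta K n m).2 scaler0.
  by rewrite (closed_coef0 x0 dx) // scale0r.
(* c cancels the coefficients of x_1 on epsilon|epsilon^k with k >= n *)
pose c : chains K := \sum_(k < n) ((x 0)@_(false, k : nat) * k.+1%:R) *:
  << (false, (k.+1 + n)%N) : chain >>.
have cE a : c@_a = \sum_(k < n) (x 0)@_(false, k : nat) * k.+1%:R *
    ((false, (k.+1 + n)%N) == a)%:R.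
  by rewrite /c raddf_sum; apply: eq_bigr => k _; rewrite /= mcoeffZ mcoeffU.
have L2 : linext R2 (x 1 + c) = \sum_(k < n) (x 1)@_(false, k : nat) * R2 (false, k : nat).
  rewrite (linext_supp (h := fun k : 'I_n => (false, k : nat) : chain)) => // [|a /outE].
    apply: eq_bigr => k _; rewrite mcoeffD cE big1 ?addr0 // => l _.
    by case: eqP => [[E]|]; [have := ltn_ord k; lia | rewrite mulr0].
  case: a => [[|] m] /= mn; first by rewrite /R2 (ribbon_basis_theta K n m).1 scaler0.
  suff -> : (x 1 + c)@_(false, m) = 0 by rewrite scale0r.
  rewrite mcoeffD -(subnK mn) (closed_coef1 dx) cE.
  case: (m - n)%N => [|l].
    rewrite oppr0 add0r big1 // => k _.
    by case: eqP => [[E]|]; [lia | rewrite mulr0].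
  have [ln|nl] := ltnP l n.
    rewrite (bigD1 (Ordinal ln)) //= eqxx big1 => [|k kl]; first by rewrite mulr1; ring.
    case: eqP => [[E]|]; last by rewrite mulr0.
    by case/eqP: kl; apply: val_inj => /=; lia.
  rewrite (closed_coef0 x0 dx nl) mulr0 oppr0 add0r big1 // => k _.
  by case: eqP => [[E]|]; [have := ltn_ord k; lia | rewrite mulr0].
have L2' : linext R2 (x 1) = \sum_(k < n) (x 1)@_(false, k : nat) * R2 (false, k : nat)
    - \sum_(k < n) (x 0)@_(false, k : nat) * k.+1%:R * R2 (false, (k.+1 + n)%N).
  rewrite -L2 raddfD /= [X in _ = _ + X - _](_ : _ = \sum_(k < n) (x 0)@_(false, k : nat) * k.+1%:R * R2 (false, (k.+1 + n)%N)).
    by rewrite addrK.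
  by rewrite /c linear_sum; apply: eq_bigr => k _; rewrite [LHS]linextZU.
rewrite T2E T3E L2' L3 mulrBr !mulr_sumr -addrA [RHS]addrC; congr (_ + _).
  by apply: eq_bigr => k _; rewrite T2E linextU; ring.
rewrite addrC -sumrB; apply: eq_bigr => k _.
by rewrite /genus_one_coef T2E T3E !linextU; ring.
Qed.

Lemma antidiagonal (M : nmodType) (H : nat -> nat -> M) (k : nat) : (k < n)%N ->
  \sum_(t < k.+1) H t (k - t)%N =
  \sum_(t < n) \sum_(r < n) (if (t + r == k)%N then H t r else 0).
Proof.
move=> kn; rewrite (big_ord_widen n (fun t => H t (k - t)%N) kn) big_mkcond.
apply: eq_bigr => t _; have [tk|kt] := leqP t.+1 k.+1.
  have rn : (k - t < n)%N by lia.
  rewrite (bigD1 (Ordinal rn)) //= subnKC // eqxx big1 ?addr0 // => r rk.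
  case: eqP => // E; case/eqP: rk; apply: val_inj => /=; lia.
by rewrite big1 // => r _; case: eqP => // E; lia.
Qed.

(** The letter u^-1 epsilon|epsilon^s is dual to epsilon|epsilon^(n-1-s): in terms of
    the dual classes the condition on s, t, r says that the exponents add up to
    2n-2. The factor 1/6 removes the orderings. *)
Definition cubic_potential : free_algebra K :=
  (6%:R^-1)%:P *: \sum_(s < n) \sum_(t < n) \sum_(r < n)
    ((s + t + r).+1 == n)%N%:R *:
      (gen (eps_pole 0 s) * gen (eps_pole 0 t) * gen (eps_pole 0 r)).

Definition linear_potential (m : nat) (c : nat -> K) : free_algebra K :=
  \sum_(k < n) (c k)%:P *: gen (eps_pole m (rev_ord k)).

(** The generating function of the invariants of types (0,3) and (1,1), written
    in the letters u^-1 and u^-2 dual to the degrees 0 and 1 of L[[u]]. Its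
    commutator with a closed x in L[[u]] is T(x), up to inert letters. The sign
    in the last term is that of the residue pairing in degree one. *)
Definition potential : free_algebra K :=
  cubic_potential + (linear_potential 0 genus_one_coef
    + linear_potential 1 (fun k => - fock_T2 n << (false, k) : chain >>)).

Lemma vacuum_linear_potential w x m c : nonneg x ->
  vacuum n (w * gen x * linear_potential m c) =
  ((-1) ^+ m * \sum_(k < n) (x m)@_(false, k : nat) * c k)%:P * vacuum n w.
Proof.
move=> x0.
apply: etrans (annihilate_linear (@vacuum_linear K n) (@free_scaler K)
  (vacuum_exchange charK n_gt0) (fun v => vacuum_last charK n_gt0 v x0) _ _ _) _.
congr (_ * _); rewrite mulr_sumr [RHS]raddf_sum; apply: eq_bigr => k _ /=.
rewrite -polyCM residue_pole //= subnSK // subKn ?(ltnW (ltn_ord k)) //.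
by congr (_%:P); ring.
Qed.

Let E w (a b : chain) : {poly K} := vacuum n (w * (gen (pole 0 a) * gen (pole 0 b))).

Lemma vacuum_theta_poles w (a b : chain) : a.1 || b.1 -> E w a b = 0.
Proof.
have inert_theta (d : chain) : d.1 -> inert n (pole 0 d).
  by case: d => [[] k] // _; apply: inert_pole.
move=> /orP[a1|b1].
  apply: etrans (congr1 (vacuum n) (mulrA _ _ _)) _.
  exact: (vacuum_inert charK n_gt0 w (gen (pole 0 b)) (inert_theta a a1)).
apply: etrans (congr1 (vacuum n) (mulrA _ _ _)) _.
apply: etrans (congr1 (vacuum n) (esym (mulr1 _))) _.
exact: (vacuum_inert charK n_gt0 (w * gen (pole 0 a)) 1 (inert_theta b b1)).
Qed.

Lemma vacuum_T1 w x : nonneg x -> laurent_diff n x = 0 ->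
  vacuum n (w * fock_T1 n (x 0)) =
  (2%:R^-1)%:P * \sum_(k < n) (x 0)@_(false, k : nat) *:
    \sum_(t < k.+1) E w (false, t : nat) (false, (k - t)%N).
Proof.
move=> x0 dx; apply: etrans (functionalZr (@vacuum_linear K n) (@free_scaler K) _ _ _) _.
congr (_ * _).
apply: etrans (functional_sum (@vacuum_linear K n) (@free_scaler K) _ _ _ _ _) _.
pose h (a : (chain * chain)%type) := E w a.1 a.2.
transitivity (linext h (coproduct n (x 0))).
  by apply: eq_bigr => a _; rewrite -mul_polyC.
have h0 (b c : chain) : b.1 || c.1 -> h (b, c) = 0 by exact: vacuum_theta_poles.
pose G (b : chain) : {poly K} := linext h (coproduct n << b >>).
have GE : linext h (coproduct n (x 0)) = linext G (x 0).
  rewrite {1}[x 0]malg_basis.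
  have -> : coproduct n (\sum_(a <- msupp (x 0)) (x 0)@_a *: << a >>) =
      \sum_(a <- msupp (x 0)) (x 0)@_a *: coproduct n << a >>.
    by rewrite /coproduct linear_sum; apply: eq_bigr => a _; rewrite linearZ.
  by rewrite linear_sum; apply: eq_bigr => a _; rewrite linearZ.
rewrite GE (linext_supp (h := fun k : 'I_n => (false, k : nat) : chain)).
- by apply: eq_bigr => k _; rewrite /G coproduct_eps //= scale1r.
- by move=> k l [] /val_inj.
case=> [[|] m] na; first by rewrite /G coproduct_eps //= scale0r scaler0.
have [mn|nm] := ltnP m n; first by have /eqP := na (Ordinal mn).
by rewrite (closed_coef0 x0 dx nm) scale0r.
Qed.

(** The coefficients of the coproduct, dualised by the pairing, form the symmetric
    tensor s + t + r = n - 1, so they are the derivatives of a cubic. *)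
Lemma vacuum_cubic w x : nonneg x -> laurent_diff n x = 0 ->
  vacuum n (w * gen x * cubic_potential) = vacuum n (w * fock_T1 n (x 0)).
Proof.
move=> x0 dx; apply: esym; apply: etrans (vacuum_T1 w x0 dx) _; apply: esym.
have nz (m : nat) : m.+1%:R != 0 :> K by have /pcharf0P -> := charK.
apply: etrans (annihilate_cubic (@vacuum_linear K n) (@free_scaler K)
  (vacuum_exchange charK n_gt0) (fun v => vacuum_last charK n_gt0 v x0) _ _ _ _ _) _.
- by move=> s t r; rewrite (addnC (s : nat) t).
- by move=> s t r; rewrite -addnA addnC.
congr (_ * _).
  rewrite -polyC_natr -polyCM; congr (_%:P).
  have -> : 6%:R^-1 = 3%:R^-1 * 2%:R^-1 :> K by rewrite -invfM -natrM.
  by rewrite mulrA divff ?mul1r.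
rewrite (reindex_inj rev_ord_inj); apply: eq_bigr => k _.
rewrite residue_pole // expr0 mul1r /= subnSK // subKn ?(ltnW (ltn_ord k)) //.
rewrite mul_polyC; congr (_ *: _).
rewrite (@antidiagonal _ (fun t r => E w (false, t) (false, r))) //.
apply: eq_bigr => t _; apply: eq_bigr => r _.
rewrite (_ : ((n - k.+1 + t + r).+1 == n)%N = (t + r == k)%N); last first.
  by have := ltn_ord k; lia.
by case: eqP => _; rewrite ?mul1r ?mul0r.
Qed.

(** Hence the deformed vacuum exp(lambda S)|0> satisfies the relations
    x = lambda T(x) to first order in lambda. *)
Lemma vacuum_potential w x : nonneg x -> laurent_diff n x = 0 ->
  vacuum n (w * gen x * potential) = vacuum n (w * fock_T n x).
Proof.
move=> x0 dx.
apply: etrans (functionalDr (@vacuum_linear K n) _ _ _) _.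
apply: etrans (congr2 +%R (vacuum_cubic w x0 dx)
  (functionalDr (@vacuum_linear K n) _ _ _)) _.
apply: esym; apply: etrans (functionalDr (@vacuum_linear K n) _ _ _) _.
congr (_ + _).
apply: etrans (functionalZr (@vacuum_linear K n) (@free_scaler K) _ _ _) _.
apply: etrans (congr1 (fun v => _ * vacuum n v) (mulr1 w)) _.
apply: esym; apply: etrans (congr2 +%R (vacuum_linear_potential w 0 _ x0)
   (vacuum_linear_potential w 1 _ x0)) _.
move: (vacuum n w) => z; rewrite -mulrDl -polyCD; congr (_%:P * _).
rewrite fock_scalarE // expr0 expr1 mul1r mulN1r -sumrN; congr (_ + _).
by apply: eq_bigr => k _; rewrite mulrN opprK.
Qed.

Definition lambda_constant_term (w : free_algebra K) : K :=
  deformed (A := free_algebra K) (vacuum n) potential w.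

Lemma lambda_constant_termD v w : lambda_constant_term (v + w) = lambda_constant_term v + lambda_constant_term w.
Proof. exact: (deformedD (A := free_algebra K) _ (@vacuum_linear K n) (@free_scaler K)). Qed.

Lemma lambda_constant_term_ideal w :
  (forall v r, vacuum n (v * w * r) = 0) -> lambda_constant_term w = 0.
Proof.
move=> w0; apply: etrans (deformedE _ (@vacuum_linear K n) (@free_scaler K) _) _.
have w1 r : vacuum n (w * r) = 0.
  exact: etrans (congr1 (vacuum n) (sandwich1 w r)) (w0 1 r).
have w2 : vacuum n w = 0 by apply: etrans (congr1 (vacuum n) (esym (mulr1 w))) (w1 1).
by have /= -> := congr2 (fun p q : {poly K} => p`_1 + q`_0) w2 (w1 potential); rewrite !coef0 addr0.
Qed.

Lemma lambda_constant_term_fock_zero w : fock_zero n w -> lambda_constant_term w = 0.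
Proof.
elim=> [{}w w0|v {}w _ v0 _ w0|{}w|{}w x wc x0 dx|{}w x x0|{}w].
- apply: lambda_constant_term_ideal; exact: (vacuum_weyl_zero charK n_gt0 w0).
- by rewrite lambda_constant_termD v0 w0 addr0.
- apply: lambda_constant_term_ideal; exact: (vacuum_boundary charK n_gt0 w).
- apply: (deformed_relation (@vacuum_linear K n) (@free_scaler K)).
    exact: (vacuum_last charK n_gt0 w x0).
  exact: vacuum_potential.
- apply: etrans (deformed_lambda _ (@vacuum_linear K n) (@free_scaler K) _) _.
  by have /= -> := congr1 (fun p : {poly K} => p`_0) (vacuum_last charK n_gt0 w x0); rewrite coef0.
- have XX : 'X ^+ 2 *: w = 'X *: ('X *: w) by rewrite scalerA.
  apply: etrans (congr1 lambda_constant_term XX) _.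
  apply: etrans (deformed_lambda _ (@vacuum_linear K n) (@free_scaler K) _) _.
  apply: etrans (congr1 (fun p : {poly K} => p`_0) (functionalZ (@vacuum_linear K n) _ _)) _.
  by rewrite coefXM.
Qed.

Lemma pole_regular m (k : 'I_n) (i : int) l : 0 <= i -> (l < n)%N ->
  (eps_pole m k i)@_(false, l) = 0.
Proof.
move=> i0 _; rewrite /eps_pole /pole /= /laurent_series /=.
have -> : i - - m.+1%:Z = (`|i|%N + m).+1%:Z by lia.
exact: mcoeff0.
Qed.

Lemma vacuum_potential0 : vacuum n potential = 0.
Proof.
have vD := functionalD (@vacuum_linear K n); have vZ := functionalZ (@vacuum_linear K n).
have sum0 (I : finType) (u : I -> free_algebra K) :
    (forall i, vacuum n (u i) = 0) -> vacuum n (\sum_i u i) = 0.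
  move=> u0; elim/big_rec: _ => [|i v _ v0]; first exact: functional0 (@vacuum_linear K n).
  exact: etrans (vD (u i) v) (etrans (congr2 +%R (u0 i) v0) (addr0 0)).
have scale0 (c : {poly K}) u : vacuum n u = 0 -> vacuum n (c *: u) = 0.
  by move=> u0; apply: etrans (vZ c u) _; rewrite u0 mulr0.
have head0 m (k : 'I_n) v : vacuum n (gen (eps_pole m k) * v) = 0.
  by apply: (vacuum_head charK n_gt0) => i l i0 ln; apply: pole_regular.
have linear0 m c : vacuum n (linear_potential m c) = 0.
  apply: (sum0) => k; apply: (scale0).
  exact: etrans (congr1 (vacuum n) (esym (mulr1 (gen (eps_pole m (rev_ord k))))))
    (head0 m (rev_ord k) 1).
have cubic0 : vacuum n cubic_potential = 0.
  apply: (scale0); do 3!(apply: (sum0) => ?); apply: (scale0).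
  exact: etrans (congr1 (vacuum n) (esym (mulrA _ _ _))) (head0 _ _ _).
have sum2 (u v : free_algebra K) :
    vacuum n u = 0 -> vacuum n v = 0 -> vacuum n (u + v) = 0.
  by move=> u0 v0; apply: etrans (vD u v) _; rewrite u0 v0 addr0.
exact: sum2 cubic0 (sum2 _ _ (linear0 _ _) (linear0 _ _)).
Qed.

Lemma lift_pole_regular (j : nat) (k : 'I_n) (i : int) l : 0 <= i -> (l < n)%N ->
  (laurent_shift (- j.+1%:Z) (lift_class K n k) i)@_(false, l) = 0.
Proof.
move=> i0 ln; rewrite /= /laurent_series /=.
have -> : i - - j.+1%:Z = (`|i|%N + j).+1%:Z by lia.
rewrite mcoeffZ mcoeffU; case: eqP => [[E']|]; last by rewrite mulr0.
by move: E'; rewrite mulnS; have := ltn_ord k; lia.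
Qed.

Definition fock_monomial (m : {cmonom (nat * 'I_n)%type}) : free_algebra K :=
  \prod_(v <- finsupp m)
    gen (laurent_shift (- v.1.+1%:Z) (lift_class K n v.2)) ^+ m v.

Lemma fock_monomial1 : fock_monomial mone = 1.
Proof.
rewrite /fock_monomial (_ : finsupp _ = fset0) ?big_seq_fset0 //.
apply/fsetP => v; rewrite in_fset0 mem_finsupp.
by apply/negbTE; rewrite negbK; apply/eqP; exact: onecmE.
Qed.

(** A nonconstant monomial starts with a letter u^-j-1 lift_class k, whose terms of
    degree at least zero involve only epsilon|epsilon^l with l > n. *)
Lemma vacuum_fock_monomial m w : m != mone -> vacuum n (fock_monomial m * w) = 0.
Proof.
move=> m1; rewrite /fock_monomial.
have [v [s [mv sE]]] : exists v s, (0 < m v)%N /\ finsupp m = v :: s :> seq _.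
  case sE: (finsupp m : seq _) => [|v s].
    case/eqP: m1; apply/eqP/cmP => v; rewrite onecmE.
    apply/eqP; rewrite -[_ == _]negbK -mem_finsupp.
    by rewrite -[v \in _]/(v \in (finsupp m : seq _)) sE.
  exists v, s; split=> //; rewrite lt0n -mem_finsupp.
  by rewrite -[v \in _]/(v \in (finsupp m : seq _)) sE mem_head.
rewrite sE.
have [u E'] := @prod_expr_head _ _ v s (fun v : nat * 'I_n =>
  gen (laurent_shift (- v.1.+1%:Z) (lift_class K n v.2))) m w mv.
apply: etrans (congr1 (vacuum n) E') _.
by apply: (vacuum_head charK n_gt0) => i l i0 ln; apply: lift_pole_regular.
Qed.

Lemma lambda_constant_term_fock_class (P : fock_poly K n) :
  lambda_constant_term (fock_class P) = (P@_mone : {poly K})`_1.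
Proof.
have vZ := functionalZ (@vacuum_linear K n).
pose c w := vacuum n (w * (1 + 'X *: potential)).
have cZ a w : c (a *: w) = a * c w.
  exact: etrans (congr1 (vacuum n) (malg_scalerAl _ _ _)) (vZ _ _).
have cD v w : c (v + w) = c v + c w.
  exact: etrans (congr1 (vacuum n) (mulrDl _ _ _)) (functionalD (@vacuum_linear K n) _ _).
have c1 : c 1 = 1.
  apply: etrans (congr1 (vacuum n) (mul1r _)) _.
  apply: etrans (functionalD (@vacuum_linear K n) _ _) _.
  apply: etrans (congr2 +%R (vacuum_one K n) (etrans (vZ _ _)
    (congr1 ( *%R _) vacuum_potential0))) _.
  by rewrite mulr0 addr0.
have main : c (fock_class P) = P@_mone.
  have E' : fock_class P = \sum_(m <- msupp P) P@_m *: fock_monomial m by [].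
  transitivity (linext (fun m => c (fock_monomial m) : {poly K}^o) P).
    apply: etrans (congr1 c E') _; rewrite /linext.
    elim/big_rec2: _ => [|m p w _ IH]; last first.
      exact: etrans (cD _ _) (congr2 +%R (cZ _ _) IH).
    exact: etrans (congr1 (vacuum n) (mul0r _)) (functional0 (@vacuum_linear K n)).
  rewrite (@linext_single _ _ _ _ P mone) => [|m m1]; last exact: vacuum_fock_monomial.
  apply: etrans (congr1 (fun w => P@_mone * c w) fock_monomial1) _.
  by rewrite c1 mulr1.
have main1 := congr1 (fun p : {poly K} => p`_1) main; exact: main1.
Qed.

End Potential.

(** * The product of three classes *)

(** The commutation relation of x and y, multiplied into a word. *)
Lemma scaled_bracket (R : comNzRingType) (A : lalgType R)
    (mulr_scaler : forall (a : R) (v w : A), v * (a *: w) = a *: (v * w))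
    (l p c : R) (s x y t : A) :
  ((l * p) *: s) * (x * y - 1 *: (y * x) - c *: 1) * t =
  l *: (p *: (s * (x * y) * t)) -
    (l *: (p *: (s * (y * x) * t)) + l *: ((p * c) *: (s * t))).
Proof.
rewrite scale1r !mulrBr !mulrBl -!scalerAl mulr_scaler mulr1 -!scalerAl.
by rewrite !scalerA opprD addrA !mulrA.
Qed.

(** Two letters that vanish on the right of a multiple of l are moved there
    through two others, leaving the two ways of contracting all four. *)
Lemma two_contractions (R : comNzRingType) (A : lalgType R) (Z : A -> Prop)
    (ZD : forall v w, Z v -> Z w -> Z (v + w)) (l p by_ by' ay ay' : R) (a b y y' : A) :
    (forall r s t, Z (l *: (r *: (s * (b * y) * t)) -
       (l *: (r *: (s * (y * b) * t)) + l *: ((r * by_) *: (s * t))))) ->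
    (forall r s t, Z (l *: (r *: (s * (b * y') * t)) -
       (l *: (r *: (s * (y' * b) * t)) + l *: ((r * by') *: (s * t))))) ->
    (forall r s t, Z (l *: (r *: (s * (a * y) * t)) -
       (l *: (r *: (s * (y * a) * t)) + l *: ((r * ay) *: (s * t))))) ->
    (forall r s t, Z (l *: (r *: (s * (a * y') * t)) -
       (l *: (r *: (s * (y' * a) * t)) + l *: ((r * ay') *: (s * t))))) ->
    (forall r w, Z (l *: (r *: (w * a)) - 0)) ->
    (forall r w, Z (l *: (r *: (w * b)) - 0)) ->
  Z (l *: (p *: (a * b * (y * y'))) - (l * (p * (by_ * ay' + by' * ay))) *: 1).
Proof.
move=> swap_by swap_by' swap_ay swap_ay' kill_a kill_b.
have trans u v w : Z (u - v) -> Z (v - w) -> Z (u - w).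
  by move=> uv vw; rewrite -(subrKA v); apply: ZD.
have add u v u' v' : Z (u - v) -> Z (u' - v') -> Z (u + u' - (v + v')).
  by move=> uv uv'; rewrite opprD addrACA; apply: ZD.
have end_ay r : Z (l *: (r *: (a * y)) - (0 + l *: ((r * ay) *: 1))).
  have := swap_ay r 1 1; rewrite !mulr1 !mul1r => H; apply: (trans _ _ _) H _.
  apply: (add); last by have := kill_a 0 0; rewrite scale0r scaler0 !subrr.
  exact: kill_a.
have end_ay' r : Z (l *: (r *: (a * y')) - (0 + l *: ((r * ay') *: 1))).
  have := swap_ay' r 1 1; rewrite !mulr1 !mul1r => H; apply: (trans _ _ _) H _.
  apply: (add); last by have := kill_a 0 0; rewrite scale0r scaler0 !subrr.
  exact: kill_a.
have H1 := swap_by p a y'; have H2 := swap_by' p (a * y) 1.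
rewrite !mulr1 !mulrA in H1 H2 *; apply: (trans _ _ _) H1 _.
have H : Z (l *: (p *: (a * y * b * y')) + l *: ((p * by_) *: (a * y'))
    - (0 + (0 + l *: ((p * by' * ay) *: 1)) + (0 + l *: ((p * by_ * ay') *: 1)))).
  apply: (add); last exact: end_ay'.
  by apply: (trans _ _ _) H2 _; apply: (add); [exact: kill_b | exact: end_ay].
rewrite (_ : (l * p * _) *: 1 =
  0 + (0 + l *: ((p * by' * ay) *: 1)) + (0 + l *: ((p * by_ * ay') *: 1))) //.
by rewrite !add0r !scalerA -scalerDl; congr (_ *: _); ring.
Qed.

(** Reduces w x to a scalar by the relation x = l (h sum q u + t), given that
    the words w u are scalars and that w vanishes. *)
Lemma relation_sum (R : comNzRingType) (A : lalgType R)
    (mulr_scaler : forall (a : R) (v w : A), v * (a *: w) = a *: (v * w))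
    (Z : A -> Prop) (Z0 : Z 0) (ZD : forall v w, Z v -> Z w -> Z (v + w))
    (I : Type) (r : seq I) (l h t : R) (q c : I -> R) (w x : A) (u : I -> A) :
    Z (w * (x - l *: (h *: \sum_(a <- r) q a *: u a + t *: 1))) ->
    (forall a, Z (l *: ((h * q a) *: (w * u a)) - (l * (h * q a * c a)) *: 1)) ->
    Z (l *: (t *: w) - 0) ->
  Z (w * x - (l * \sum_(a <- r) h * q a * c a) *: 1).
Proof.
move=> Zx Zu Zt.
suff Zr : Z (l *: (w * (h *: \sum_(a <- r) q a *: u a + t *: 1))
    - (l * \sum_(a <- r) h * q a * c a) *: 1).
  by have := ZD _ _ Zx Zr; rewrite mulrBr mulr_scaler subrKA.
rewrite mulrDr scalerDr mulr_scaler mulr_scaler mulr1 addrAC -[l *: (t *: w)]subr0.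
apply: (ZD) Zt; rewrite !mulr_sumr !scaler_sumr scaler_suml -sumrB.
elim/big_rec: _ => [|a v _ Zv]; first exact: Z0.
by apply: (ZD) Zv; rewrite mulr_scaler (scalerA h); apply: (Zu).
Qed.

Lemma word_diff2 (A : pzRingType) (z p u z' p' q : A) :
  z * p + u * (z' * p' + q * 0) = 1 * z * p + u * z' * p'.
Proof. by rewrite mulr0 addr0 mul1r mulrA. Qed.

Section ThreePoint.
Context (K : fieldType) (n : nat) (n_gt0 : (0 < n)%N).
Implicit Types (x y : laurent K) (u v w s t : free_algebra K) (p : {poly K}).
Local Notation lambda := ('X : {poly K}).

(** The recursion of the coefficients lift_coef is b x_(l+1) = - B x_l. *)
Lemma lift_class_closed (k : 'I_n) : laurent_diff n (lift_class K n k) = 0.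
Proof.
apply: val_inj; apply: boolp.funext => i; apply/malgP => -[[] l]; rewrite /= mcoeffD; last first.
  by rewrite hoch_b_eps connes_B_eps addr0 mcoeff0.
rewrite mcoeff0 hoch_b_theta connes_B_theta /laurent_series.
case: i => [[|m]|m] /=.
- rewrite mcoeffZ mcoeffU [(_ == _)](_ : _ = false) ?mulr0 ?add0r.
    by case: l => // l; rewrite mcoeff0 mulr0.
  by apply/eqP => -[]; have := ltn_ord k; lia.
- rewrite subn1 /= mcoeffZ mcoeffU; case: l => [|l].
    rewrite addr0 [(_ == _)](_ : _ = false) ?mulr0 //.
    by apply/eqP => -[]; lia.
  rewrite mcoeffZ mcoeffU.
  rewrite (_ : (_ == (false, (l.+1 + n)%N)) = ((k + n * m + m)%N == l)); last first.
    by apply/eqP/eqP => [[]|]; [lia | move=> <-; congr (_, _); lia].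
  rewrite (_ : (_ == (false, l)) = ((k + n * m + m)%N == l)); last first.
    by apply/eqP/eqP => [[]|-> //].
  case: eqP => [E|_]; last by rewrite !mulr0 addr0.
  rewrite /lift_coef big_ord_recr /= (_ : (k + 1 + m * n.+1)%N = l.+1); last by lia.
  rewrite exprS; ring.
- by rewrite mcoeff0 add0r; case: l => // l; rewrite mcoeff0 mulr0.
Qed.

Lemma lift_class_nonneg (k : 'I_n) : nonneg (lift_class K n k).
Proof. by case=> [i|i]. Qed.

Lemma lift_class_even (k : 'I_n) : homogeneous false (lift_class K n k).
Proof.
move=> i a; rewrite /= /laurent_series; case: i => [l|l]; last by rewrite mcoeff0 eqxx.
by rewrite mcoeffZ mcoeffU; case: (_ =P a) => [<- //|_]; rewrite mulr0 eqxx.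
Qed.

Lemma pole_homogeneous m (a : chain) : homogeneous a.1 (pole K m a).
Proof.
move=> i b; rewrite /pole /= /laurent_series /=.
case: (_ - _) => [[|l]|l]; rewrite ?mcoeff0 ?eqxx // mcoeffU.
by case: (_ =P b) => [-> //|_]; rewrite eqxx.
Qed.

Lemma weyl_zero_gen0 : weyl_zero n (gen (0 : laurent K)).
Proof.
have := weyl_linear n (-1) (0 : laurent K) 0.
have -> : (-1) *: (0 : laurent K) + 0 = 0 by rewrite scaler0 addr0.
have -> : (-1)%:P *: gen (0 : laurent K) + gen 0 = 0.
  by rewrite polyCN polyC1 scaleN1r addNr.
by rewrite subr0.
Qed.

Lemma fock_zero_eq u v : u = v -> fock_zero n u -> fock_zero n v.
Proof. by move=> ->. Qed.

Lemma weyl_zero_eq u v : u = v -> weyl_zero n u -> weyl_zero n v.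
Proof. by move=> ->. Qed.

Lemma weyl_cycle2 x y : laurent_diff n x = 0 -> laurent_diff n y = 0 ->
  weyl_cycle n (gen x * gen y).
Proof.
move=> dx dy; rewrite /weyl_cycle.
have xyE : gen x * gen y = << mmul (fmu x) (fmu y) >> := malg_mulU _ _ _.
have wE : mmul (fmu x) (fmu y) = [:: x; y] :> seq _ by rewrite fmM !fmU.
pose one := \prod_(z <- [::]) gen z : free_algebra K.
have dE : weyl_diff n (gen x * gen y) =
    gen (laurent_diff n x) * \prod_(z <- [:: y]) gen z
    + gen (laurent_sign x) * (gen (laurent_diff n y) * one + gen (laurent_sign y) * 0).
  apply: etrans (congr1 (weyl_diff n) xyE) _.
  apply: etrans (linextU _ _) _.
  exact: etrans (congr1 (word_diff n) wE) _.
rewrite dx dy in dE.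
apply: weyl_zero_eq (esym (etrans dE (word_diff2 _ _ _ _ _ _))) _.
by apply: weyl_zeroD; apply/weyl_zeroM/weyl_zero_gen0.
Qed.

Lemma fock_zero0 : fock_zero n (0 : free_algebra K).
Proof. exact/fock_zero_weyl/weyl_zero0. Qed.

Lemma fock_swap x y q p s t : homogeneous false x -> homogeneous q y ->
  fock_zero n (lambda *: (p *: (s * (gen x * gen y) * t)) -
    (lambda *: (p *: (s * (gen y * gen x) * t)) +
     lambda *: ((p * (residue_pairing n x y)%:P) *: (s * t)))).
Proof.
move=> hx hy; apply: fock_zero_weyl.
apply: weyl_zero_eq (scaled_bracket (@free_scaler K) _ _ _ _ _ _ _) _.
exact: weyl_zeroM (weyl_commutator n hx hy).
Qed.

Lemma fock_kill x p w : nonneg x -> fock_zero n (lambda *: (p *: (w * gen x)) - 0).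
Proof.
move=> x0; apply: fock_zero_eq (esym (subr0 _)) _.
apply: fock_zero_eq (congr1 (fun u => lambda *: u) (malg_scalerAl p w (gen x))) _.
exact: fock_lambda.
Qed.

Lemma fock_contract2 x x' y y' q q' p :
    nonneg x -> nonneg x' -> homogeneous false x -> homogeneous false x' ->
    homogeneous q y -> homogeneous q' y' ->
  fock_zero n (lambda *: (p *: (gen x * gen x' * (gen y * gen y'))) -
    (lambda * (p * (residue_pairing n x' y * residue_pairing n x y'
      + residue_pairing n x' y' * residue_pairing n x y)%:P)) *: 1).
Proof.
move=> x0 x'0 hx hx' hy hy'; rewrite polyCD !polyCM.
apply: (two_contractions (A := free_algebra K) (@fock_zeroD K n)).
- by move=> r s t; apply: fock_swap hx' hy.
- by move=> r s t; apply: fock_swap hx' hy'.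
- by move=> r s t; apply: fock_swap hx hy.
- by move=> r s t; apply: fock_swap hx hy'.
- by move=> r w; apply: fock_kill.
- by move=> r w; apply: fock_kill.
Qed.

Let contractions (i j : 'I_n) (a : (chain * chain)%type) : K :=
  residue_pairing n (lift_class K n j) (pole K 0 a.1)
    * residue_pairing n (lift_class K n i) (pole K 0 a.2)
  + residue_pairing n (lift_class K n j) (pole K 0 a.2)
    * residue_pairing n (lift_class K n i) (pole K 0 a.1).

(** Applying the relation to the last class leaves the words formed by the first
    two classes and the two outputs of the coproduct, which are contracted. The
    genus one scalars multiply a word that ends in L[[u]]. *)
Lemma three_classes (i j k : 'I_n) :
  fock_zero n (gen (lift_class K n i) * gen (lift_class K n j) * gen (lift_class K n k)
    - (lambda * (2%:R^-1 * linext (contractions i j : _ -> K^o)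
         (coproduct n (lift_class K n k 0)))%:P) *: 1).
Proof.
pose D := coproduct n (lift_class K n k 0).
have E : (2%:R^-1 * linext (contractions i j : _ -> K^o) D)%:P =
    \sum_(a <- msupp D) (2%:R^-1)%:P * (D@_a)%:P * (contractions i j a)%:P :> {poly K}.
  rewrite polyCM [X in _ * X]raddf_sum mulr_sumr; apply: eq_bigr => a _ /=.
  by rewrite [in LHS]/GRing.scale /= polyCM mulrA.
rewrite -/D E.
apply: (relation_sum (A := free_algebra K) (@free_scaler K) fock_zero0 (@fock_zeroD K n)).
- apply: fock_relation (lift_class_nonneg k) (lift_class_closed k).
  exact: weyl_cycle2 (lift_class_closed i) (lift_class_closed j).
- move=> a; apply: (@fock_contract2 _ _ _ _ a.1.1 a.2.1).
  + exact: lift_class_nonneg.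
  + exact: lift_class_nonneg.
  + exact: lift_class_even.
  + exact: lift_class_even.
  + exact: pole_homogeneous.
  + exact: pole_homogeneous.
- exact: fock_kill (lift_class_nonneg j).
Qed.

Context (charK : [pchar K] =i pred0).

Lemma lift_pole_pairing (i : 'I_n) (s : nat) : (s < n)%N ->
  residue_pairing n (lift_class K n i) (pole K 0 (false, s)) = ((i : nat) + s.+1 == n)%N%:R.
Proof.
move=> sn; have := residue_pole charK n_gt0 0 (Ordinal sn) (lift_class_nonneg i).
rewrite expr0 mul1r => ->; rewrite /= /lift_coef big_ord0 mcoeffZ mcoeffU expr0 !mul1r.
congr (nat_of_bool _)%:R; apply/idP/idP => /eqP.
  by case=> E; apply/eqP; lia.
by move=> E; apply/eqP; congr (_, _); lia.
Qed.

Lemma lift_theta_pairing (i : 'I_n) (s : nat) :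
  residue_pairing n (lift_class K n i) (pole K 0 (true, s)) = 0.
Proof.
rewrite -(propagator_commutator charK n_gt0) !(propagator_eq0 charK n_gt0) ?subr0 //.
  by left=> l m _; apply: inert_pole.
by right=> l m _; apply: inert_pole.
Qed.

(** Both ways of contracting count the pairs (t, k-t) that are dual to the first two
    classes: there is one if the exponents add up to 2n-2, and none otherwise. *)
Lemma three_point_value (i j k : 'I_n) :
  2%:R^-1 * linext (contractions i j : _ -> K^o) (coproduct n (lift_class K n k 0)) =
  if (i + j + k == 2 * n - 2)%N then 1 else 0 :> K.
Proof.
have lk0 : lift_class K n k 0 = << (false, k : nat) : chain >>.
  by rewrite /= /lift_coef big_ord0 expr0 mulr1 scale1r muln0 !addn0.
rewrite lk0 coproduct_eps => [|b c]; last first.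
  case: b c => [[] b] [[] c] //= _; rewrite /contractions /=.
  - by rewrite (lift_theta_pairing j b) (lift_theta_pairing i b) mul0r mulr0 addr0.
  - by rewrite (lift_theta_pairing j b) (lift_theta_pairing i b) mul0r mulr0 addr0.
  - by rewrite (lift_theta_pairing j c) (lift_theta_pairing i c) mul0r mulr0 addr0.
pose d : K := ((i + j + k == 2 * n - 2)%N)%:R.
have sumd (a b : 'I_n) : ((a + b + k == 2 * n - 2)%N)%:R = \sum_(t < k.+1)
    (b + t.+1 == n)%N%:R * (a + (k - t).+1 == n)%N%:R :> K.
  have := ltn_ord a; have := ltn_ord b; have := ltn_ord k => kn bn an.
  case: eqP => [E|E].
    have tk : (n - b.+1 < k.+1)%N by lia.
    rewrite (bigD1 (Ordinal tk)) //= big1 => [|t tb].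
      have -> : (b + (n - b.+1).+1 == n)%N by apply/eqP; lia.
      have -> : (a + (k - (n - b.+1)).+1 == n)%N by apply/eqP; lia.
      by rewrite mulr1 addr0.
    case: eqP => [E'|]; last by rewrite mul0r.
    by case/eqP: tb; apply: val_inj => /=; lia.
  rewrite big1 // => t _; have := ltn_ord t => tk.
  case: eqP => [E1|]; last by rewrite mul0r.
  by case: eqP => [E2|]; [lia | rewrite mulr0].
rewrite scale1r big_split /=.
have -> : \sum_(t < k.+1) residue_pairing n (lift_class K n j) (pole K 0 (false, t : nat))
    * residue_pairing n (lift_class K n i) (pole K 0 (false, (k - t)%N)) = d.
  rewrite /d sumd; apply: eq_bigr => t _.
  have tk := ltn_ord t; have kn := ltn_ord k.
  by rewrite (lift_pole_pairing j) ?(lift_pole_pairing i) //; lia.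
have -> : \sum_(t < k.+1) residue_pairing n (lift_class K n j) (pole K 0 (false, (k - t)%N))
    * residue_pairing n (lift_class K n i) (pole K 0 (false, t : nat)) = d.
  rewrite /d (addnC (i : nat)) sumd; apply: eq_bigr => t _.
  have tk := ltn_ord t; have kn := ltn_ord k.
  by rewrite (lift_pole_pairing j) ?(lift_pole_pairing i) 1?mulrC //; lia.
have nz : 2%:R != 0 :> K by have /pcharf0P -> := charK.
rewrite -mulr2n -[d *+ 2]mulr_natl mulrA mulVf // mul1r /d.
by case: (_ == _).
Qed.

End ThreePoint.

Theorem proposition2p8 (K : fieldType) (charK : [pchar K] =i pred0)
    (n : nat) (n_ge1 : (1 <= n)%N) (i j k : 'I_n) :
  costello_03 i j k (if (i + j + k == 2 * n - 2)%N then 1 else 0 : K).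
Proof.
pose v : K := if (i + j + k == 2 * n - 2)%N then 1 else 0.
pose P : fock_poly K n := ('X * v%:P) *: << mone >>.
have PE : fock_class P = ('X * v%:P) *: 1.
  apply: etrans (linextZU _ _ _) _; congr (_ *: _); exact: fock_monomial1.
have Prep : fock_represents P
    (gen (lift_class K n i) * gen (lift_class K n j) * gen (lift_class K n k)).
  rewrite /fock_represents PE /v -(three_point_value n_ge1 charK i j k).
  exact: three_classes.
split; first by exists P.
move=> Q Qrep; rewrite -/v.
have coefE (R : fock_poly K n) w : fock_represents R w ->
    lambda_constant_term n w = (R@_mone : {poly K})`_1.
  move=> wR; rewrite -(lambda_constant_term_fock_class charK n_ge1).
  apply: etrans (congr1 (lambda_constant_term n) (esym (subrK (fock_class R) w))) _.
  apply: etrans (lambda_constant_termD _ _ _) _.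
  by rewrite (lambda_constant_term_fock_zero charK n_ge1 wR) add0r.
apply: etrans (esym (coefE Q _ Qrep)) (etrans (coefE P _ Prep) _).
by rewrite /P mcoeffZ mcoeffUU mulr1 coefXM coefC.
Qed.
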